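(* Let $d\ge 1$ and $g(t)=e^{-\pi|t|^2}$, $t\in\mathbb{R}^d$. Suppose there exist $R>0$, $N>1$ and $f\in L^2(\mathbb{R}^d)$, $f\neq 0$, such that \[ |V_g f(x,\omega)|\le \frac{|\langle f,g\rangle|}{N}\quad\text{for all } x\in\mathbb{R}^d \text{ and all } \omega\in\mathbb{R}^d \text{ with } |\omega|=R. \] Then $R>\sqrt{\dfrac{\log N}{\pi}}$.
   Context: For $f,g\in L^2(\mathbb{R}^d)$, the short-time Fourier transform is $V_g f(x,\omega)=\int_{\mathbb{R}^d} e^{-2\pi i t\cdot\omega} f(t)\overline{g(t-x)}\,dt$ for $(x,\omega)\in\mathbb{R}^{2d}$, and $\langle f,g\rangle=\int_{\mathbb{R}^d} f(t)\overline{g(t)}\,dt$ is the $L^2$ inner product. $|\cdot|$ denotes the Euclidean norm and $\log$ the natural logarithm. *)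

(* Defs.v *)
From mathcomp Require Import all_boot all_order all_algebra.
From mathcomp Require Import all_classical all_reals all_analysis.

Set Implicit Arguments.
Unset Strict Implicit.
Unset Printing Implicit Defensive.

Import Order.TTheory GRing.Theory Num.Theory.
Import numFieldNormedType.Exports.

Local Open Scope classical_set_scope.
Local Open Scope ring_scope.

(* Points of R^d are d-tuples of reals; d.-tuple R carries the product
   (= Borel) sigma-algebra of MathComp-Analysis. *)

Section Defs.
Variable R : realType.

Definition dotp (d : nat) (t w : d.-tuple R) : R :=
  \sum_(i < d) tnth t i * tnth w i.

Definition enorm (d : nat) (t : d.-tuple R) : R := Num.sqrt (dotp t t).

Definition subv (d : nat) (t x : d.-tuple R) : d.-tuple R :=
  [tuple tnth t i - tnth x i | i < d].

Definition gauss (d : nat) (t : d.-tuple R) : R := expR (- pi * dotp t t).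

(* Lebesgue integral over R^d, written as the iterated one-dimensional
   Lebesgue integral (equal to the integral w.r.t. d-dimensional Lebesgue
   measure for nonnegative measurable or integrable integrands, by
   Tonelli/Fubini). *)
Fixpoint iint (n : nat) : (n.-tuple R -> \bar R) -> \bar R :=
  match n return (n.-tuple R -> \bar R) -> \bar R with
  | 0 => fun F => F [tuple]
  | n'.+1 => fun F =>
      (\int[@lebesgue_measure R]_x iint (fun t : n'.-tuple R => F (cons_tuple x t)))%E
  end.

(* A complex-valued function f : R^d -> C is represented by its real part
   fr and imaginary part fi. *)

Definition L2 (d : nat) (fr fi : d.-tuple R -> R) : Prop :=
  [/\ measurable_fun [set: d.-tuple R] fr,
      measurable_fun [set: d.-tuple R] fi &
      (iint (fun t => ((fr t) ^+ 2 + (fi t) ^+ 2)%:E) < +oo)%E].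

Definition L2_nonzero (d : nat) (fr fi : d.-tuple R -> R) : Prop :=
  iint (fun t => ((fr t) ^+ 2 + (fi t) ^+ 2)%:E) <> 0%E.

(* real and imaginary parts of V_g f(x,w)
     = int e^{-2 pi i t.w} f(t) conj(g(t-x)) dt,
   with e^{-i th} = cos th - i sin th and g real-valued *)
Definition stft_re (d : nat) (fr fi : d.-tuple R -> R) (x w : d.-tuple R) : R :=
  fine (iint (fun t =>
    ((fr t * cos (2 * pi * dotp t w) + fi t * sin (2 * pi * dotp t w))
       * gauss (subv t x))%:E)).

Definition stft_im (d : nat) (fr fi : d.-tuple R -> R) (x w : d.-tuple R) : R :=
  fine (iint (fun t =>
    ((fi t * cos (2 * pi * dotp t w) - fr t * sin (2 * pi * dotp t w))
       * gauss (subv t x))%:E)).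

Definition stft_abs (d : nat) (fr fi : d.-tuple R -> R) (x w : d.-tuple R) : R :=
  Num.sqrt (stft_re fr fi x w ^+ 2 + stft_im fr fi x w ^+ 2).

Definition inner_re (d : nat) (fr fi : d.-tuple R -> R) : R :=
  fine (iint (fun t => (fr t * gauss t)%:E)).
Definition inner_im (d : nat) (fr fi : d.-tuple R -> R) : R :=
  fine (iint (fun t => (fi t * gauss t)%:E)).

Definition inner_abs (d : nat) (fr fi : d.-tuple R -> R) : R :=
  Num.sqrt (inner_re fr fi ^+ 2 + inner_im fr fi ^+ 2).

End Defs.

(* Main.v *)
(** Fix [x0] and write [V(x, w)] for the short-time Fourier transform at
    [(x0 + x e1, w e1)]. Up to a unimodular factor, [exp (pi w^2) V(x, w)] is the
    entire function [G(x + i w) = \int f(t) exp (- pi (t - x0 - (x + i w) e1)^2) dt],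
    which tends to [0] as [|x| -> oo] in the strip [|w| <= R]. If
    [R <= sqrt (ln N / pi)] then [exp (pi R^2) / N <= 1], so the hypothesis bounds
    [|G|] by [C = |<f, g>|] on both boundary lines.

    The maximum principle applied to [|G| + eta b], with [b] strictly subharmonic,
    zero on the boundary lines and positive at the centre, gives [|G(0)| < m] for
    every [m > 0] with [C <= m]. Holomorphy enters only through the approximate
    mean value property over the four points [z +- r], [z +- i r], which passes to
    [G] from the kernel by linearity of the integral.

    If [C > 0], taking [x0 = 0] and [m = C] gives [C = |G(0)| < C]. If [C = 0], all
    the Gaussian translates are orthogonal to [f], so the two-sided Laplace
    transform of [f g] vanishes. Then [f = 0] almost everywhere: moments vanish by
    difference quotients, the exponential series then shows that [f g] may be
    multiplied by further Gaussians, and polynomials in Gaussians converge boundedly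
    to indicators of intervals; the coordinates are treated one at a time. *)

From HB Require Import structures.
Require Import Defs.
From mathcomp Require Import all_boot all_order all_algebra.
From mathcomp Require Import all_classical all_reals all_analysis.
From mathcomp Require Import measurable_realfun ring lra.

Set Implicit Arguments.
Unset Strict Implicit.
Unset Printing Implicit Defensive.

Import Order.TTheory GRing.Theory Num.Theory.
Import numFieldNormedType.Exports.
Local Open Scope classical_set_scope.
Local Open Scope ring_scope.

(** * The iterated integral as an integral against a measure *)

Section iterated_integral.
Local Open Scope ereal_scope.
Variable R : realType.
Notation leb := (@lebesgue_measure R).

(** Only two frequencies of the sphere are used, the two multiples of [e1] of norm [R], so one
    complex variable suffices in every dimension and the other coordinates stay inside the integral
    as parameters. A bound on the two lines alone would not exclude growth along the strip; the
    decay cuts the strip down to a rectangle. The ordinary maximum principle yields only a weak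
    inequality, which is no contradiction when [R] is exactly [sqrt (ln N / pi)]; hence the weight
    of the barrier is kept fixed instead of being sent to zero. No derivative of [G] is taken: the
    four-point error of the kernel is cubic in [r] with an integrable majorant, whereas the barrier
    gains a multiple of [r ^+ 2]. In the uniqueness part the Gaussian is spent in portions: a part
    of it makes an L2 function integrable, and the rest absorbs exponentials, powers and partial
    sums of the exponential series. *)

Lemma measurable_integral_snd (d d' : measure_display) (P : measurableType d)
    (T : measurableType d') (m : {sigma_finite_measure set T -> \bar R})
    (F : P * T -> \bar R) :
  measurable_fun setT F -> measurable_fun setT (fun p => \int[m]_x F (p, x)).
Proof.
move=> mF.
rewrite (_ : (fun p => _) =
  (fubini_F m F^\+) \- (fubini_F m F^\-)); last first.
  apply/funext => p; rewrite integralE /fubini_F.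
  under eq_integral do rewrite funepos_comp/=.
  by under [X in _ - X = _]eq_integral do rewrite funeneg_comp/=.
apply: emeasurable_funB; apply: measurable_fun_fubini_tonelli_F => //.
- exact: measurable_funepos.
- exact: measurable_funeneg.
Qed.

(** The parameter space is arbitrary so that the induction can move the outermost integration
    variable into it. *)
Lemma measurable_iint n (d : measure_display) (P : measurableType d)
    (F : P -> n.-tuple R -> \bar R) :
  measurable_fun [set: P * n.-tuple R] (fun q => F q.1 q.2) ->
  measurable_fun [set: P] (fun p => iint (F p)).
Proof.
elim: n d P F => [|n IH] d P F mF /=.
  have : measurable_fun [set: P] (fun p => (p, [tuple] : 0.-tuple R)).
    exact: measurable_fun_pair.
  by move/(measurableT_comp mF).
have := IH _ (P * measurableTypeR R)%type (fun q t => F q.1 (cons_tuple q.2 t)).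
move=> /(_ _)/measurable_integral_snd; apply.
have : measurable_fun [set: (P * measurableTypeR R) * n.-tuple R]
    (fun q => (q.1.1, cons_tuple q.1.2 q.2)).
  apply: measurable_fun_pair => /=.
    by apply: measurableT_comp.
  apply: measurable_cons => //.
  by apply: measurableT_comp.
by move/(measurableT_comp mF).
Qed.

Lemma sigma_finite_product (d1 d2 : measure_display)
    (T1 : measurableType d1) (T2 : measurableType d2)
    (m1 : {sigma_finite_measure set T1 -> \bar R})
    (m2 : {sigma_finite_measure set T2 -> \bar R}) :
  sigma_finite setT (m1 \x m2).
Proof.
have /sigma_finiteP[F [TF ndF Foo]] := sigma_finiteT m1.
have /sigma_finiteP[G [TG ndG Goo]] := sigma_finiteT m2.
exists (fun k => F k `*` G k) => [|k]; last first.
  have [mF Fk] := Foo k; have [mG Gk] := Goo k.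
  split; first exact: measurableX.
  by rewrite product_measure1E// lte_mul_pinfty// ge0_fin_numE.
apply/seteqP; split=> // -[x y] _.
have [i _ Fix] : (\bigcup_k F k) x by rewrite -TF.
have [j _ Gjy] : (\bigcup_k G k) y by rewrite -TG.
exists (maxn i j) => //; split.
- by move: x Fix; exact/subsetPset/ndF/leq_maxl.
- by move: y Gjy; exact/subsetPset/ndG/leq_maxr.
Qed.

Lemma sigma_finite_pushforward (d1 d2 : measure_display)
    (T1 : measurableType d1) (T2 : measurableType d2)
    (m : {measure set T1 -> \bar R}) (phi : T1 -> T2) (psi : T2 -> T1) :
  measurable_fun setT psi -> cancel phi psi -> sigma_finite setT m ->
  sigma_finite setT (pushforward m phi).
Proof.
move=> mpsi phiK [F TF Foo].
exists (fun i => psi @^-1` F i).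
  by rewrite -preimage_bigcup -TF preimage_setT.
move=> i; have [mF Fi] := Foo i; split.
  by rewrite -[X in measurable X]setTI; exact: mpsi.
by rewrite /pushforward -comp_preimage (_ : _ \o _ = id)//; apply/funext.
Qed.

Lemma integrable_pushforwardP (d1 d2 : measure_display)
    (T1 : measurableType d1) (T2 : measurableType d2)
    (m : {measure set T1 -> \bar R}) (phi : T1 -> T2) (F : T2 -> \bar R)
    (mphi : measurable_fun setT phi) :
  (pushforward m phi).-integrable setT F -> m.-integrable setT (F \o phi).
Proof.
move=> /integrableP[mF Foo]; apply/integrableP; split.
  exact: measurableT_comp.
rewrite ge0_integral_pushforward// in Foo.
exact: measurableT_comp.
Qed.

(** Opens [iint] to linearity, dominated convergence and almost-everywhere arguments. The measure
    copies the recursion: a Dirac mass at the empty tuple, then the product with [leb] transported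
    along [cons_tuple]. *)
Lemma exists_iint_measure n :
  exists m : {sigma_finite_measure set (n.-tuple R) -> \bar R},
    (forall F, measurable_fun setT F -> (forall t, 0 <= F t) ->
      iint F = \int[m]_t F t) /\
    (forall F, m.-integrable setT F -> iint F = \int[m]_t F t).
Proof.
elim: n => [|n [m [IH0 IH]]].
  exists [the {sigma_finite_measure set (0.-tuple R) -> \bar R} of
    \d_([tuple] : 0.-tuple R)]; split=> F.
    by move=> mF _; rewrite integral_dirac//= diracT mul1e.
  by move=> /integrableP[mF _]; rewrite integral_dirac//= diracT mul1e.
pose phi (q : measurableTypeR R * n.-tuple R) : n.+1.-tuple R :=
  cons_tuple q.1 q.2.
pose psi (t : n.+1.-tuple R) : measurableTypeR R * n.-tuple R :=
  (thead t, behead_tuple t).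
have mphi : measurable_fun setT phi by exact: measurable_cons.
have mpsi : measurable_fun setT psi.
  apply: measurable_fun_pair; first exact: measurable_tnth.
  exact: measurable_behead.
have phiK : cancel phi psi.
  by move=> [x t]; congr pair; exact: val_inj.
pose mn := pushforward (leb \x m) phi.
pose M1 : {measure set (n.+1.-tuple R) -> \bar R} :=
  @measure_function_pushforward__canonical__measure_function_Measure
     _ _ _ _ _ (leb \x m) phi mphi.
have sfM : sigma_finite setT M1.
  rewrite /M1/=.
  exact: (sigma_finite_pushforward mpsi phiK (sigma_finite_product leb m)).
(* Sigma-finiteness travels with the measure because the product at the next dimension requires
   it. *)
pose M :=
  HB.pack_for {sigma_finite_measure set (n.+1.-tuple R) -> \bar R} mn (Measure.class M1)
    (isSFinite.Build _ _ _ mn (sfinite_measure_sigma_finite sfM))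
    (isSigmaFinite.Build _ _ _ mn sfM).
exists (M mphi); split=> F.
  move=> mF F0 /=.
  rewrite [RHS](ge0_integral_pushforward mphi)//=.
  rewrite [RHS]fubini_tonelli1//; last by apply: measurableT_comp.
  apply: eq_integral => x _; apply: IH0 => //.
  apply: measurableT_comp => //.
  exact: measurable_cons.
move=> iF /=.
have iFp := integrable_pushforwardP mphi iF.
have mF : measurable_fun setT F by case/integrableP : iF.
rewrite [RHS](integral_pushforward mphi)//= -integral12_prod_meas1//.
(* The sections of [F] are integrable for almost every [x] only, so the induction hypothesis
   identifies the inner integrals almost everywhere. *)
apply: ae_eq_integral => //.
- apply: (@measurable_iint n _ (measurableTypeR R)
    (fun x t => F (cons_tuple x t))).
  exact: measurableT_comp.
- apply: measurable_integral_snd; exact: measurableT_comp.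
- apply: filterS (ae_integrable1 iFp) => x ix _; exact: IH.
Qed.
End iterated_integral.

(** * Taylor bounds *)

Section taylor_bounds.
Variable R : realType.
Implicit Types p q x m : R.

(** Each Taylor bound below follows from a bound on the derivative. The factorials are lost on the
    way; only the order in [x] matters later. *)
Lemma mvt_bound (f df : R -> R) (x K : R) :
  (forall c : R, is_derive c (1 : R) f (df c)) -> f 0 = 0 ->
  (forall c, `|c| <= `|x| -> `|df c| <= K) -> `|f x| <= K * `|x|.
Proof.
move=> fdf f0 dfK.
have cf (i : interval R) : {within [set` i], continuous f}.
  by apply: derivable_within_continuous => y _; exact: ex_derive.
have [x0|x0] := leP 0 x.
- have [c] := @MVT_segment _ f df 0 x x0 (fun y _ => fdf y) (cf _).
  rewrite in_itv/= f0 !subr0 => /andP[c0 cx] ->.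
  rewrite normrM ler_wpM2r// dfK// !ger0_norm//.
- have [c] := @MVT_segment _ f df x 0 (ltW x0) (fun y _ => fdf y) (cf _).
  rewrite in_itv/= f0 !sub0r => /andP[c0 cx] /eqP.
  rewrite mulrN eqr_opp => /eqP ->.
  rewrite normrM ler_wpM2r// dfK// ler0_norm// ltr0_norm// lerN2//.
Qed.

Lemma expR_normr_le c x : `|c| <= `|x| -> expR c <= expR `|x|.
Proof. by move=> cx; rewrite ler_expR (le_trans (ler_norm _)). Qed.

Lemma expR_taylor0 x : `|expR x - 1| <= `|x| * expR `|x|.
Proof.
rewrite mulrC; apply: (@mvt_bound (fun x => expR x - 1) expR).
- by move=> c; apply: is_derive_eq; rewrite ?subr0.
- by rewrite expR0 subrr.
- by move=> c cx; rewrite ger0_norm ?expR_ge0// expR_normr_le.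
Qed.

Lemma expR_taylor1 x : `|expR x - 1 - x| <= `|x| ^+ 2 * expR `|x|.
Proof.
rewrite expr2 -mulrA mulrC; apply: (@mvt_bound (fun x => expR x - 1 - x) (fun x => expR x - 1)).
- by move=> c; apply: is_derive_eq; rewrite ?subr0.
- by rewrite expR0 subrr subr0.
- move=> c cx; apply: le_trans (expR_taylor0 c) _.
  by rewrite ler_pM// ?expR_ge0// ler_expR.
Qed.

Lemma expR_taylor2 x : `|expR x - 1 - x - x ^+ 2 / 2| <= `|x| ^+ 3 * expR `|x|.
Proof.
rewrite exprS -[leRHS]mulrA [leRHS]mulrC.
apply: (@mvt_bound (fun x => expR x - 1 - x - x ^+ 2 / 2) (fun x => expR x - 1 - x)).
- by move=> c; apply: is_derive_eq; rewrite ?subr0 /GRing.scale/=; lra.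
- by rewrite expR0 subrr subr0 expr0n/= mul0r subrr.
- move=> c cx; apply: le_trans (expR_taylor1 c) _.
  by rewrite ler_pM// ?expR_ge0 ?exprn_ge0// ?ler_expR// lerXn2r// nnegrE.
Qed.

Lemma cos_taylor0 x : `|cos x - 1| <= `|x|.
Proof.
rewrite -[leRHS]mul1r; apply: (@mvt_bound (fun x => cos x - 1) (fun x => - sin x)).
- by move=> c; apply: is_derive_eq; rewrite ?subr0.
- by rewrite cos0 subrr.
- by move=> c _; rewrite normrN sin_max.
Qed.

Lemma sin_taylor0 x : `|sin x| <= `|x|.
Proof.
rewrite -[leRHS]mul1r; apply: (@mvt_bound (fun x => sin x) cos).
- exact: sin0.
- by move=> c _; exact: cos_max.
Qed.

Lemma cos_taylor1 x : `|cos x - 1| <= `|x| ^+ 2.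
Proof.
rewrite expr2; apply: (@mvt_bound (fun x => cos x - 1) (fun x => - sin x)).
- by move=> c; apply: is_derive_eq; rewrite ?subr0.
- by rewrite cos0 subrr.
- by move=> c cx; rewrite normrN (le_trans (sin_taylor0 _)).
Qed.

Lemma sin_taylor1 x : `|sin x - x| <= `|x| ^+ 2.
Proof.
rewrite expr2; apply: (@mvt_bound (fun x => sin x - x) (fun x => cos x - 1)).
- by rewrite sin0 subrr.
- by move=> c cx; rewrite (le_trans (cos_taylor0 _)).
Qed.

Lemma sin_taylor2 x : `|sin x - x| <= `|x| ^+ 3.
Proof.
rewrite exprSr; apply: (@mvt_bound (fun x => sin x - x) (fun x => cos x - 1)).
- by rewrite sin0 subrr.
- by move=> c cx; rewrite (le_trans (cos_taylor1 _))// lerXn2r// nnegrE.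
Qed.

Lemma cos_taylor2 x : `|cos x - 1 + x ^+ 2 / 2| <= `|x| ^+ 3.
Proof.
rewrite [leRHS]exprSr.
apply: (@mvt_bound (fun x => cos x - 1 + x ^+ 2 / 2) (fun x => x - sin x)).
- by move=> c; apply: is_derive_eq; rewrite ?subr0 /GRing.scale/=; lra.
- by rewrite cos0 subrr expr0n/= mul0r addr0.
- move=> c cx; rewrite distrC (le_trans (sin_taylor1 _))// lerXn2r// nnegrE//.
Qed.

(** Real part of [exp z = 1 + z + z^2 / 2 + O(m^3 exp m)] at [z = p + i q]; the next lemma is the
    imaginary part, where [z^2 / 2] contributes [p * q]. *)
Lemma cexp_re_taylor2 p q m : `|p| <= m -> `|q| <= m ->
  `|expR p * cos q - 1 - p - (p ^+ 2 - q ^+ 2) / 2| <= 3 * m ^+ 3 * expR m.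
Proof.
move=> pm qm; have m0 : 0 <= m := le_trans (normr_ge0 p) pm.
have em : expR `|p| <= expR m by rewrite ler_expR.
have ep : expR p <= expR m by rewrite ler_expR (le_trans (ler_norm _)).
have em0 := expR_ge0 m.
(* The last summand corrects for the quadratic term of [cos q] having been multiplied by [expR p]
   instead of 1. *)
have -> : expR p * cos q - 1 - p - (p ^+ 2 - q ^+ 2) / 2 =
  expR p * (cos q - 1 + q ^+ 2 / 2) + (expR p - 1 - p - p ^+ 2 / 2) -
  (expR p - 1) * (q ^+ 2 / 2) by field.
have q3 : `|q| ^+ 3 <= m ^+ 3 by rewrite lerXn2r// nnegrE.
have p3 : `|p| ^+ 3 <= m ^+ 3 by rewrite lerXn2r// nnegrE.
have q2 : `|q ^+ 2 / 2| <= m ^+ 2.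
  rewrite normrM normrX (ger0_norm (_ : 0 <= 2^-1))//.
  apply: le_trans (_ : `|q| ^+ 2 <= _); last by rewrite lerXn2r// nnegrE.
  by rewrite ler_piMr ?exprn_ge0//; lra.
have A1 : `|expR p * (cos q - 1 + q ^+ 2 / 2)| <= expR m * m ^+ 3.
  rewrite normrM (ger0_norm (expR_ge0 _)) ler_pM ?expR_ge0//.
  exact: le_trans (cos_taylor2 _) _.
have A2 : `|expR p - 1 - p - p ^+ 2 / 2| <= m ^+ 3 * expR m.
  by apply: le_trans (expR_taylor2 _) _; rewrite ler_pM ?exprn_ge0 ?expR_ge0.
have A3 : `|(expR p - 1) * (q ^+ 2 / 2)| <= m * expR m * m ^+ 2.
  rewrite normrM ler_pM//; apply: le_trans (expR_taylor0 _) _.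
  by rewrite ler_pM ?expR_ge0.
apply: le_trans (ler_normB _ _) _; apply: le_trans (lerD (ler_normD _ _) (lexx _)) _.
apply: le_trans (lerD (lerD A1 A2) A3) _.
rewrite le_eqVlt; apply/orP; left; apply/eqP; ring.
Qed.

Lemma cexp_im_taylor2 p q m : `|p| <= m -> `|q| <= m ->
  `|expR p * sin q - q - p * q| <= 3 * m ^+ 3 * expR m.
Proof.
move=> pm qm; have m0 : 0 <= m := le_trans (normr_ge0 p) pm.
have em : expR `|p| <= expR m by rewrite ler_expR.
have ep : expR p <= expR m by rewrite ler_expR (le_trans (ler_norm _)).
have em0 := expR_ge0 m.
have -> : expR p * sin q - q - p * q =
  expR p * (sin q - q) + (expR p - 1 - p) * q by ring.
have q3 : `|q| ^+ 3 <= m ^+ 3 by rewrite lerXn2r// nnegrE.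
have p2 : `|p| ^+ 2 <= m ^+ 2 by rewrite lerXn2r// nnegrE.
have A1 : `|expR p * (sin q - q)| <= expR m * m ^+ 3.
  rewrite normrM (ger0_norm (expR_ge0 _)) ler_pM ?expR_ge0//.
  exact: le_trans (sin_taylor2 _) _.
have A3 : `|(expR p - 1 - p) * q| <= m ^+ 2 * expR m * m.
  rewrite normrM ler_pM//; apply: le_trans (expR_taylor1 _) _.
  by rewrite ler_pM ?exprn_ge0 ?expR_ge0.
apply: le_trans (ler_normD _ _) _.
apply: le_trans (lerD A1 A3) _.
have : 0 <= expR m * m ^+ 3 by rewrite mulr_ge0// exprn_ge0.
have -> : m ^+ 2 * expR m * m = expR m * m ^+ 3 by ring.
have -> : 3 * m ^+ 3 * expR m = 3 * (expR m * m ^+ 3) by ring.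
lra.
Qed.

Lemma cexp_re_taylor0 p q m : `|p| <= m -> `|q| <= m ->
  `|expR p * cos q - 1| <= 2 * m * expR m.
Proof.
move=> pm qm; have m0 : 0 <= m := le_trans (normr_ge0 p) pm.
have em : expR `|p| <= expR m by rewrite ler_expR.
have ep : expR p <= expR m by rewrite ler_expR (le_trans (ler_norm _)).
have -> : expR p * cos q - 1 = expR p * (cos q - 1) + (expR p - 1) by ring.
have A1 : `|expR p * (cos q - 1)| <= expR m * m.
  rewrite normrM (ger0_norm (expR_ge0 _)) ler_pM ?expR_ge0//.
  exact: le_trans (cos_taylor0 _) _.
have A2 : `|expR p - 1| <= m * expR m.
  by apply: le_trans (expR_taylor0 _) _; rewrite ler_pM ?expR_ge0.
apply: le_trans (ler_normD _ _) _; apply: le_trans (lerD A1 A2) _.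
rewrite le_eqVlt; apply/orP; left; apply/eqP; ring.
Qed.

Lemma cexp_im_taylor0 p q m : `|p| <= m -> `|q| <= m ->
  `|expR p * sin q| <= 2 * m * expR m.
Proof.
move=> pm qm; have m0 : 0 <= m := le_trans (normr_ge0 p) pm.
have ep : expR p <= expR m by rewrite ler_expR (le_trans (ler_norm _)).
rewrite normrM (ger0_norm (expR_ge0 _)).
have A1 : expR p * `|sin q| <= expR m * m.
  by rewrite ler_pM ?expR_ge0// (le_trans (sin_taylor0 _)).
apply: le_trans A1 _.
have -> : 2 * m * expR m = expR m * m + expR m * m by ring.
by rewrite lerDl mulr_ge0// expR_ge0.
Qed.

End taylor_bounds.

(** * The Gaussian kernel in a strip *)

Section strip_kernel.
Variable R : realType.
Implicit Types a y h k r : R.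

(* [strip_cos a y - i strip_sin a y = exp (- pi (a + i y)^2)] *)
Definition strip_cos a y : R :=
  expR (pi * (y ^+ 2 - a ^+ 2)) * cos (2 * pi * (a * y)).
Definition strip_sin a y : R :=
  expR (pi * (y ^+ 2 - a ^+ 2)) * sin (2 * pi * (a * y)).

(** With [z = a + i y] and [u = h + i k], [shift_re + i shift_im] is [- pi (2 z u + u^2)], the
    change of the exponent [- pi z^2] when [z] moves to [z + u]. *)
Definition shift_re a y h k : R :=
  pi * (2 * y * k + k ^+ 2 - 2 * a * h - h ^+ 2).
Definition shift_im a y h k : R := - (2 * pi * (a * k + h * y + h * k)).

Lemma strip_shiftE a y h k :
  let p := shift_re a y h k in let q := shift_im a y h k in
  strip_cos (a + h) (y + k) =
    expR p * cos q * strip_cos a y + expR p * sin q * strip_sin a y /\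
  strip_sin (a + h) (y + k) =
    expR p * cos q * strip_sin a y - expR p * sin q * strip_cos a y.
Proof.
move=> p q; rewrite /strip_cos /strip_sin.
have -> : pi * ((y + k) ^+ 2 - (a + h) ^+ 2) = pi * (y ^+ 2 - a ^+ 2) + p.
  by rewrite /p /shift_re; ring.
have -> : 2 * pi * ((a + h) * (y + k)) = 2 * pi * (a * y) - q.
  by rewrite /q /shift_im; ring.
by rewrite expRD cosB sinB; split; ring.
Qed.

(** Bounds both parts of the exponent increment per unit of a shift [r <= 1]; the summand 1 absorbs
    the terms quadratic in the shift. *)
Definition strip_rate a y : R := 2 * pi * (`|a| + `|y| + 1).

Lemma strip_rate_ge1 a y : 1 <= strip_rate a y.
Proof.
rewrite /strip_rate; have := pi_ge2 R; have := normr_ge0 a; have := normr_ge0 y.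
by move=> *; nra.
Qed.

Lemma shift_re_le a y h k r : `|h| <= r -> `|k| <= r -> r <= 1 ->
  `|shift_re a y h k| <= r * strip_rate a y.
Proof.
move=> hr kr r1; have pi0 := pi_gt0 R.
have r0 : 0 <= r := le_trans (normr_ge0 _) hr.
rewrite /shift_re normrM (gtr0_norm pi0) /strip_rate.
have -> : r * (2 * pi * (`|a| + `|y| + 1)) = pi * (2 * `|y| * r + 2 * `|a| * r + r + r).
  by ring.
rewrite ler_wpM2l ?(ltW pi0)//.
have e1 : `|2 * y * k| <= 2 * `|y| * r.
  by rewrite !normrM (ger0_norm (_ : 0 <= 2))// ler_wpM2l// mulr_ge0.
have e2 : `|2 * a * h| <= 2 * `|a| * r.
  by rewrite !normrM (ger0_norm (_ : 0 <= 2))// ler_wpM2l// mulr_ge0.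
have e3 : `|k ^+ 2| <= r.
  rewrite normrX expr2 -[leRHS]mulr1; apply: ler_pM => //.
  exact: le_trans kr r1.
have e4 : `|h ^+ 2| <= r.
  rewrite normrX expr2 -[leRHS]mulr1; apply: ler_pM => //.
  exact: le_trans hr r1.
apply: le_trans (ler_normB _ _) _; rewrite lerD//.
apply: le_trans (ler_normB _ _) _.
have := ler_normD (2 * y * k) (k ^+ 2); lra.
Qed.

Lemma shift_im_le a y h k r : `|h| <= r -> `|k| <= r -> r <= 1 ->
  `|shift_im a y h k| <= r * strip_rate a y.
Proof.
move=> hr kr r1; have pi0 := pi_gt0 R.
have r0 : 0 <= r := le_trans (normr_ge0 _) hr.
rewrite /shift_im normrN normrM normrM (gtr0_norm pi0) (ger0_norm (_ : 0 <= 2))// /strip_rate.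
have -> : r * (2 * pi * (`|a| + `|y| + 1)) = 2 * pi * (`|a| * r + r * `|y| + r).
  by ring.
rewrite ler_wpM2l ?mulr_ge0 ?(ltW pi0)//.
apply: le_trans (ler_normD _ _) _; rewrite lerD//.
  apply: le_trans (ler_normD _ _) _; rewrite lerD// normrM.
    by rewrite ler_wpM2l.
  by rewrite ler_wpM2r.
by rewrite normrM -[leRHS]mulr1; apply: ler_pM => //; exact: le_trans kr r1.
Qed.

Lemma expR_cube_le (L : R) : 0 <= L -> L ^+ 3 * expR L <= expR (4 * L).
Proof.
move=> L0; have LL : L <= expR L by have := expR_ge1Dx L; lra.
have -> : 4 * L = L + (L + L) + L by ring.
by rewrite !expRD ler_wpM2r ?expR_ge0// exprS ler_pM ?exprn_ge0// expr2 ler_pM.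
Qed.

(** A common majorant for the first-order and the four-point differences. The constant is
    [26 = 2 * (4 * 3 + 1)]: four Taylor remainders with constant 3, one quartic residue, and two
    products in [strip_comb_le]. The factor [expR (4 * L)] swallows [L ^+ 3 * expR L]; it grows only
    exponentially in [a], so the Gaussian still wins. *)
Definition strip_dom a y : R :=
  26 * expR (4 * strip_rate a y) * expR (pi * (y ^+ 2 - a ^+ 2)).

Lemma strip_comb_le a y (u v w K : R) :
  0 <= K -> `|u| <= K -> `|v| <= K ->
  w = u * strip_cos a y + v * strip_sin a y ->
  `|w| <= 2 * K * expR (pi * (y ^+ 2 - a ^+ 2)).
Proof.
move=> K0 uK vK ->; apply: le_trans (ler_normD _ _) _.
have -> : 2 * K * expR (pi * (y ^+ 2 - a ^+ 2)) =
   K * expR (pi * (y ^+ 2 - a ^+ 2)) + K * expR (pi * (y ^+ 2 - a ^+ 2)) by ring.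
apply: lerD; rewrite normrM ler_pM// normrM (ger0_norm (expR_ge0 _));
  by rewrite ler_piMr ?expR_ge0 ?cos_max ?sin_max.
Qed.

Lemma strip_lip a y h k r : `|h| <= r -> `|k| <= r -> r <= 1 ->
  `|strip_cos (a + h) (y + k) - strip_cos a y| <= strip_dom a y * r /\
  `|strip_sin (a + h) (y + k) - strip_sin a y| <= strip_dom a y * r.
Proof.
move=> hr kr r1; have r0 : 0 <= r := le_trans (normr_ge0 _) hr.
have [-> ->] := strip_shiftE a y h k.
have pb := shift_re_le a y hr kr r1; have qb := shift_im_le a y hr kr r1.
have re := cexp_re_taylor0 pb qb; have im := cexp_im_taylor0 pb qb.
set p := shift_re a y h k in re im *; set q := shift_im a y h k in re im *.
set L := strip_rate a y in re im *.
have L1 : 1 <= L by exact: strip_rate_ge1.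
set E := expR (pi * (y ^+ 2 - a ^+ 2)).
have KL : 2 * (r * L) * expR (r * L) <= 13 * expR (4 * L) * r.
  have rL : r * L <= L by rewrite ler_piMl//; lra.
  have -> : 2 * (r * L) * expR (r * L) = 2 * r * (L * expR (r * L)) by ring.
  have -> : 13 * expR (4 * L) * r = 13 * r * expR (4 * L) by ring.
  apply: ler_pM; [by rewrite mulr_ge0|by rewrite mulr_ge0 ?expR_ge0//; lra|by lra|].
  apply: le_trans (expR_cube_le _); last lra.
  rewrite ler_pM ?expR_ge0 ?ler_expR//; first lra.
  by rewrite -[leLHS]expr1 ler_weXn2l.
have K0 : 0 <= 13 * expR (4 * L) * r by rewrite !mulr_ge0 ?expR_ge0.
have -> : strip_dom a y * r = 2 * (13 * expR (4 * L) * r) * E.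
  by rewrite /strip_dom /E -/L; ring.
split.
- apply: (@strip_comb_le a y (expR p * cos q - 1) (expR p * sin q)) => //.
  + exact: le_trans re KL.
  + exact: le_trans im KL.
  + by ring.
- apply: (@strip_comb_le a y (- (expR p * sin q)) (expR p * cos q - 1)) => //.
  + by rewrite normrN; exact: le_trans im KL.
  + exact: le_trans re KL.
  + by ring.
Qed.

(* The shifts [h] range over [r] times the fourth roots of unity, whose sum and
   sum of squares vanish, so that only third-order terms survive. *)
Lemma strip_four_point a y r : 0 <= r -> r <= 1 ->
  `|strip_cos (a + r) y + strip_cos (a - r) y + strip_cos a (y + r)
    + strip_cos a (y - r) - 4 * strip_cos a y| <= strip_dom a y * r ^+ 3 /\
  `|strip_sin (a + r) y + strip_sin (a - r) y + strip_sin a (y + r)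
    + strip_sin a (y - r) - 4 * strip_sin a y| <= strip_dom a y * r ^+ 3.
Proof.
move=> r0 r1.
have nr : `|r| <= r by rewrite ger0_norm.
have nnr : `|- r| <= r by rewrite normrN ger0_norm.
have n0 : `|0 : R| <= r by rewrite normr0.
have shift (h k : R) (hr : `|h| <= r) (kr : `|k| <= r) :
    [/\ strip_cos (a + h) (y + k) =
      expR (shift_re a y h k) * cos (shift_im a y h k) * strip_cos a y +
      expR (shift_re a y h k) * sin (shift_im a y h k) * strip_sin a y,
    strip_sin (a + h) (y + k) =
      expR (shift_re a y h k) * cos (shift_im a y h k) * strip_sin a y -
      expR (shift_re a y h k) * sin (shift_im a y h k) * strip_cos a y,
    `|expR (shift_re a y h k) * cos (shift_im a y h k) - 1 - shift_re a y h k -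
      (shift_re a y h k ^+ 2 - shift_im a y h k ^+ 2) / 2| <=
      3 * (r * strip_rate a y) ^+ 3 * expR (r * strip_rate a y) &
    `|expR (shift_re a y h k) * sin (shift_im a y h k) - shift_im a y h k -
      shift_re a y h k * shift_im a y h k| <=
      3 * (r * strip_rate a y) ^+ 3 * expR (r * strip_rate a y)].
  have [e1 e2] := strip_shiftE a y h k.
  have pb := shift_re_le a y hr kr r1; have qb := shift_im_le a y hr kr r1.
  split=> //; [exact: cexp_re_taylor2|exact: cexp_im_taylor2].
have [c1 s1 re1 im1] := shift r 0 nr n0.
have [c2 s2 re2 im2] := shift (- r) 0 nnr n0.
have [c3 s3 re3 im3] := shift 0 r n0 nr.
have [c4 s4 re4 im4] := shift 0 (- r) n0 nnr.
rewrite !addr0 in c1 s1 c2 s2 c3 s3 c4 s4.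
rewrite c1 c2 c3 c4 s1 s2 s3 s4 {c1 c2 c3 c4 s1 s2 s3 s4}.
have sp : shift_re a y r 0 + shift_re a y (- r) 0 + shift_re a y 0 r + shift_re a y 0 (- r) = 0.
  by rewrite /shift_re; ring.
have sq : shift_im a y r 0 + shift_im a y (- r) 0 + shift_im a y 0 r + shift_im a y 0 (- r) = 0.
  by rewrite /shift_im; ring.
have spq : shift_re a y r 0 * shift_im a y r 0 + shift_re a y (- r) 0 * shift_im a y (- r) 0 +
   shift_re a y 0 r * shift_im a y 0 r + shift_re a y 0 (- r) * shift_im a y 0 (- r) = 0.
  by rewrite /shift_im /shift_re; ring.
(* The squares of the exponents do not cancel completely: all four shifts have fourth power
   [r ^+ 4], which leaves this real residue. *)
have spp : (shift_re a y r 0 ^+ 2 - shift_im a y r 0 ^+ 2) / 2 +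
   (shift_re a y (- r) 0 ^+ 2 - shift_im a y (- r) 0 ^+ 2) / 2 +
   (shift_re a y 0 r ^+ 2 - shift_im a y 0 r ^+ 2) / 2 +
   (shift_re a y 0 (- r) ^+ 2 - shift_im a y 0 (- r) ^+ 2) / 2 = 2 * (pi * pi) * r ^+ 4.
  by rewrite /shift_im /shift_re; field.
set L := strip_rate a y in re1 re2 re3 re4 im1 im2 im3 im4 *.
have L1 : 1 <= L by exact: strip_rate_ge1.
have KL : 12 * (r * L) ^+ 3 * expR (r * L) + 2 * (pi * pi) * r ^+ 4 <= 13 * expR (4 * L) * r ^+ 3.
  have rL : r * L <= L by rewrite ler_piMl//; lra.
  have r3 : 0 <= r ^+ 3 by rewrite exprn_ge0.
  have e1 : L ^+ 3 * expR (r * L) <= expR (4 * L).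
    apply: le_trans (expR_cube_le _); last lra.
    by rewrite ler_wpM2l ?exprn_ge0 ?ler_expR//; lra.
  have e2 : 2 * (pi * pi) <= expR (4 * L) :> R.
    have Lpi : 2 * pi <= L.
      rewrite /L /strip_rate ler_peMr ?mulr_ge0 ?pi_ge0//.
      have := normr_ge0 a; have := normr_ge0 y; lra.
    apply: le_trans (expR_cube_le _); last lra.
    apply: (@le_trans _ _ (L ^+ 3)); last first.
      by rewrite ler_peMr ?exprn_ge0 -?expR0 ?ler_expR//; lra.
    have := pi_ge2 R => p2.
    have : L ^+ 2 <= L ^+ 3 by rewrite ler_weXn2l.
    apply: le_trans; rewrite expr2.
    have : (2 * pi) * (2 * pi) <= L * L by apply: ler_pM => //; rewrite mulr_ge0 ?pi_ge0.
    have : 0 <= pi * pi :> R by rewrite mulr_ge0 ?pi_ge0.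
    nra.
  have r43 : r ^+ 4 <= r ^+ 3 by rewrite exprS ler_piMl.
  have -> : 12 * (r * L) ^+ 3 * expR (r * L) = r ^+ 3 * (12 * (L ^+ 3 * expR (r * L))) by ring.
  apply: (@le_trans _ _ (r ^+ 3 * (12 * expR (4 * L)) + r ^+ 3 * expR (4 * L))); last first.
    rewrite le_eqVlt; apply/orP; left; apply/eqP; ring.
  apply: lerD; first by rewrite ler_wpM2l// ler_wpM2l.
  rewrite [leLHS]mulrC; apply: ler_pM => //; first exact: exprn_ge0.
  by rewrite !mulr_ge0 ?pi_ge0.
have r40 : 0 <= 2 * (pi * pi) * r ^+ 4 by rewrite !mulr_ge0 ?exprn_ge0 ?pi_ge0.
have K0 : 0 <= 13 * expR (4 * L) * r ^+ 3 by rewrite !mulr_ge0 ?expR_ge0 ?exprn_ge0.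
have -> : strip_dom a y * r ^+ 3 = 2 * (13 * expR (4 * L) * r ^+ 3) * expR (pi * (y ^+ 2 - a ^+ 2)).
  by rewrite /strip_dom -/L; ring.
have K12 : 12 * (r * L) ^+ 3 * expR (r * L) = 4 * (3 * (r * L) ^+ 3 * expR (r * L)) by ring.
move: re1 re2 re3 re4 im1 im2 im3 im4; rewrite !ler_norml.
move: (3 * (r * L) ^+ 3 * expR (r * L)) K12 KL => D -> KL.
set u1 := expR _ * cos _; set u2 := expR _ * cos _.
set u3 := expR _ * cos _; set u4 := expR _ * cos _.
move=> /andP[re1 re1'] /andP[re2 re2'] /andP[re3 re3'] /andP[re4 re4'].
set v1 := expR _ * sin _; set v2 := expR _ * sin _.
set v3 := expR _ * sin _; set v4 := expR _ * sin _.
move=> /andP[im1 im1'] /andP[im2 im2'] /andP[im3 im3'] /andP[im4 im4'].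
have reb : `|u1 + u2 + u3 + u4 - 4| <= 13 * expR (4 * L) * r ^+ 3.
  by rewrite ler_norml; apply/andP; split; lra.
have imb : `|v1 + v2 + v3 + v4| <= 13 * expR (4 * L) * r ^+ 3.
  by rewrite ler_norml; apply/andP; split; lra.
rewrite -!ler_norml; split.
- apply: (@strip_comb_le a y (u1 + u2 + u3 + u4 - 4) (v1 + v2 + v3 + v4)) => //.
  by ring.
- apply: (@strip_comb_le a y (- (v1 + v2 + v3 + v4)) (u1 + u2 + u3 + u4 - 4)) => //.
    by rewrite normrN.
  by ring.
Qed.

End strip_kernel.

(** * A strict maximum principle on rectangles *)

Section maximum_principle.
Variable R : realType.
Implicit Types x y r : R.

(** Used for continuity, hence for the existence of a maximum on a compact rectangle. *)
Definition locally_lipschitz2 (v : R -> R -> R) := forall x y, exists C : R,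
  forall h k r, `|h| <= r -> `|k| <= r -> r <= 1 ->
    `|v (x + h) (y + k) - v x y| <= C * r.

(** A four-point form of subharmonicity. It is applied at a single maximum point, so [C] may depend
    on the point, and an error of order above two is harmless against the gain of [barrier]. *)
Definition almost_submean (v : R -> R -> R) := forall x y, exists C : R,
  forall r, 0 <= r -> r <= 1 ->
    4 * v x y <= v (x + r) y + v (x - r) y + v x (y + r) + v x (y - r) + C * r ^+ 3.

Lemma locally_lipschitz2_continuous v :
  locally_lipschitz2 v -> continuous (fun z : R * R => v z.1 z.2).
Proof.
move=> lv [x y] /=; have [C hC] := lv x y.
apply/cvgrPdist_lt => e e0.
have C0 : 0 < `|C| + 1 by rewrite ltr_wpDl.
pose dl := Num.min 1 (e / (`|C| + 1) / 2).
have dl0 : 0 < dl by rewrite lt_min ltr01 !divr_gt0.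
apply: filterS (nbhsx_ballx ((x, y) : R * R) dl dl0) => -[x' y'] [/= bx by_].
have xx : `|x' - x| <= dl by rewrite distrC ltW.
have yy : `|y' - y| <= dl by rewrite distrC ltW.
have dl1 : dl <= 1 by rewrite ge_min lexx.
have := hC _ _ _ xx yy dl1; rewrite !(addrC x) !(addrC y) !subrK distrC.
move=> /le_lt_trans; apply.
apply: (@le_lt_trans _ _ ((`|C| + 1) * dl)).
  by rewrite ler_wpM2r ?(ltW dl0)// (le_trans (ler_norm _))// lerDl.
apply: (@le_lt_trans _ _ (e / 2)).
  apply: le_trans (_ : (`|C| + 1) * (e / (`|C| + 1) / 2) <= _).
    by rewrite ler_wpM2l ?(ltW C0)// ge_min lexx orbT.
  by rewrite mulrA mulrCA divff ?gt_eqF// mulr1.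
lra.
Qed.

(** [expR u + expR (- u) - 2] is the square of [expR (u / 2) - expR (- (u / 2))], so the claim
    reduces to [sinh w >= w] for [w >= 0]; the same identity shows that the derivative there is
    nonnegative. *)
Lemma cosh_lower_bound (u : R) : 2 + u ^+ 2 <= expR u + expR (- u).
Proof.
have sinh_ge (w : R) : 0 <= w -> 2 * w <= expR w - expR (- w).
  move=> w0; pose f (t : R) := expR t - expR (- t) - 2 * t.
  pose df (t : R) := expR t + expR (- t) - 2.
  have fdf (c : R) : is_derive c (1 : R) f (df c).
    by apply: is_derive_eq; rewrite /df /GRing.scale/=; ring.
  have [|c _] := @MVT_segment _ f df 0 w w0 (fun y _ => fdf y).
    by apply: derivable_within_continuous => y _; exact: ex_derive.
  rewrite {2}/f !oppr0 subrr mulr0 ?oppr0 !addr0 /f => fw.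
  suff : 0 <= df c * w by rewrite -fw; lra.
  rewrite mulr_ge0// /df.
  have -> : expR c + expR (- c) - 2 = (expR (c / 2) - expR (- (c / 2))) ^+ 2.
    rewrite sqrrB -!expRM_natl -expRD subrr expR0.
    rewrite mulrN !(mulrC _ (c / 2)) divfK ?pnatr_eq0//; ring.
  exact: sqr_ge0.
wlog u0 : u / 0 <= u => [hw|].
  have [/hw//|u0] := leP 0 u.
  by have := hw (- u); rewrite opprK sqrrN addrC (addrC (expR _)) (addrC (_ ^+ 2)); apply; lra.
have := sinh_ge (u / 2) (divr_ge0 u0 (ler0n _ _)).
rewrite mulrCA divff ?pnatr_eq0// mulr1 => h.
have : u ^+ 2 <= (expR (u / 2) - expR (- (u / 2))) ^+ 2.
  by rewrite lerXn2r ?nnegrE// (le_trans u0).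
rewrite sqrrB -!expRM_natl -expRD subrr expR0.
rewrite mulrN !(mulrC _ (u / 2)) divfK ?pnatr_eq0//; lra.
Qed.

(* Strictly subharmonic, positive at the centre of the strip [|y| <= S] and
   zero on its boundary: adding it to a bounded submean function makes the
   maximum principle strict. *)
Definition barrier (S x y : R) : R := expR (4 / S * x) * (S ^+ 2 - y ^+ 2) ^+ 2.

(** At order [r ^+ 2] the vertical neighbours contribute [12 y^2 - 4 S^2], which is negative near
    the centre line. The horizontal ones contribute [(4 / S)^2 (S^2 - y^2)^2], largest exactly
    there. With the rate [4 / S] the sum exceeds [5 S^2], by completing a square in [y^2]. *)
Lemma barrier_submean S x y r : 0 < S -> `|y| <= S ->
  4 * barrier S x y + 5 * S ^+ 2 * r ^+ 2 * expR (4 / S * x) <=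
  barrier S (x + r) y + barrier S (x - r) y + barrier S x (y + r)
    + barrier S x (y - r).
Proof.
move=> S0 yS; rewrite /barrier mulrDr mulrBr !expRD.
set E := expR (4 / S * x); set k := 4 / S.
have E0 : 0 <= E by exact: expR_ge0.
have ch : 2 + (k * r) ^+ 2 <= expR (k * r) + expR (- (k * r)).
  exact: cosh_lower_bound.
set q := (S ^+ 2 - y ^+ 2) ^+ 2.
have q0 : 0 <= q by exact: sqr_ge0.
have -> : E * expR (k * r) * q + E * expR (- (k * r)) * q =
   E * ((expR (k * r) + expR (- (k * r))) * q) by ring.
have h1 : (2 + (k * r) ^+ 2) * q <= (expR (k * r) + expR (- (k * r))) * q.
  by rewrite ler_wpM2r.
have h2 : (k * r) ^+ 2 * q = r ^+ 2 * (16 / S ^+ 2 * q).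
  by rewrite /k; field; rewrite gt_eqF.
have h3 : 0 <= r ^+ 2 * (16 / S ^+ 2 * q + 12 * y ^+ 2 - 9 * S ^+ 2).
  rewrite mulr_ge0 ?sqr_ge0//.
  have -> : 16 / S ^+ 2 * q + 12 * y ^+ 2 - 9 * S ^+ 2 =
    (16 * (S ^+ 2 - y ^+ 2) ^+ 2 + 12 * y ^+ 2 * S ^+ 2 - 9 * S ^+ 4) / S ^+ 2.
    by rewrite /q; field; rewrite gt_eqF.
  rewrite divr_ge0 ?sqr_ge0//.
  have -> : 16 * (S ^+ 2 - y ^+ 2) ^+ 2 + 12 * y ^+ 2 * S ^+ 2 - 9 * S ^+ 4 =
    (4 * y ^+ 2 - 5 / 2 * S ^+ 2) ^+ 2 + 3 / 4 * (S ^+ 2) ^+ 2 by field.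
  by rewrite addr_ge0 ?sqr_ge0// mulr_ge0 ?sqr_ge0//; lra.
have h4 : 0 <= r ^+ 4 by rewrite (exprM r 2 2) sqr_ge0.
have h5 : (S ^+ 2 - (y + r) ^+ 2) ^+ 2 + (S ^+ 2 - (y - r) ^+ 2) ^+ 2 =
   2 * q + r ^+ 2 * (12 * y ^+ 2 - 4 * S ^+ 2) + 2 * r ^+ 4 by rewrite /q; ring.
rewrite -[leRHS]addrA -!mulrDr h5.
have -> : 4 * (E * q) + 5 * S ^+ 2 * r ^+ 2 * E =
  E * (4 * q + 5 * S ^+ 2 * r ^+ 2) by ring.
rewrite ler_wpM2l//.
move: h3; rewrite mulrBr mulrDr -h2 => h3.
lra.
Qed.

(** The barrier vanishes on the horizontal sides and so leaves the bound [M] intact; its cost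
    appears only on the vertical sides, where [V] can be made small. *)
Lemma strip_maximum (v : R -> R -> R) (S X M V eta : R) :
  locally_lipschitz2 v -> almost_submean v -> 0 < S -> 0 < X -> 0 < eta ->
  (forall x, `|x| <= X -> v x S <= M) -> (forall x, `|x| <= X -> v x (- S) <= M) ->
  (forall y, `|y| <= S -> v X y <= V) -> (forall y, `|y| <= S -> v (- X) y <= V) ->
  v 0 0 + eta * S ^+ 4 <= Num.max M (V + eta * (expR (4 / S * X) * S ^+ 4)).
Proof.
move=> lv sv S0 X0 eta0 MS MNS VX VNX.
pose K : set (R * R) := `[- X, X] `*` `[- S, S].
pose W (z : R * R) := v z.1 z.2 + eta * barrier S z.1 z.2.
have cW : continuous W.
  move=> z; apply: cvgD; first exact: locally_lipschitz2_continuous.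
  apply: cvgM; first exact: cvg_cst.
  apply: cvgM.
    apply: (@cvg_comp _ _ _ (fun z : R * R => 4 / S * z.1) expR).
      by apply: cvgM; [exact: cvg_cst|exact: cvg_fst].
    exact: continuous_expR.
  by apply: cvgM; (apply: cvgB; [exact: cvg_cst|
    apply: cvgM; exact: cvg_snd]).
have KP z : K z <-> `|z.1| <= X /\ `|z.2| <= S.
  by rewrite /K /= !in_itv/= !ler_norml.
have K00 : K (0, 0) by apply/KP; rewrite /= normr0; split; exact: ltW.
have cK : compact K by apply: compact_setX; exact: segment_compact.
have [[x y] /[!inE] Kxy maxW] := @compact_EVT_max _ R W K (ex_intro _ _ K00) cK
  (continuous_subspaceT cW).
have {Kxy} [xX yS] := (KP _).1 Kxy; rewrite /= in xX yS.
have W0 : W (0, 0) = v 0 0 + eta * S ^+ 4.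
  by rewrite /W /barrier/= mulr0 expR0 mul1r expr0n/= subr0 -exprM.
rewrite -W0; apply: le_trans (maxW (0, 0) _) _; first by rewrite inE.
rewrite /W/=.
have [->|nyS] := eqVneq y S.
  by rewrite /barrier subrr expr0n/= !mulr0 addr0 le_max MS.
have [->|nyNS] := eqVneq y (- S).
  by rewrite /barrier sqrrN subrr expr0n/= !mulr0 addr0 le_max MNS.
have bb x' : x' <= X -> barrier S x' y <= expR (4 / S * X) * S ^+ 4.
  move=> x'X; rewrite /barrier ler_pM ?expR_ge0 ?sqr_ge0//.
    by rewrite ler_expR ler_wpM2l// divr_ge0// ltW.
  have -> : S ^+ 4 = (S ^+ 2) ^+ 2 by rewrite -exprM.
  rewrite lerXn2r ?nnegrE ?sqr_ge0// ?subr_ge0 ?gerBl ?sqr_ge0//.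
  by rewrite -[y ^+ 2]real_normK ?num_real// lerXn2r// nnegrE// ltW.
have xleX : x <= X := le_trans (ler_norm _) xX.
have [xEX|nxX] := eqVneq x X.
  rewrite le_max; apply/orP; right; rewrite lerD ?ler_wpM2l ?(ltW eta0) ?bb//.
  by rewrite xEX VX.
have [xENX|nxNX] := eqVneq x (- X).
  rewrite le_max; apply/orP; right; rewrite lerD ?ler_wpM2l ?(ltW eta0) ?bb//.
  by rewrite xENX VNX.
(* At an interior maximum the four neighbours cannot exceed the centre, yet the barrier forces their
   sum above four times its value. *)
exfalso.
have [C hC] := sv x y.
have xX' : 0 < X - `|x|.
  rewrite subr_gt0 lt_neqAle xX andbT eqr_norml negb_and negb_or.
  by rewrite nxX nxNX.
have yS' : 0 < S - `|y|.
  rewrite subr_gt0 lt_neqAle yS andbT eqr_norml negb_and negb_or.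
  by rewrite nyS nyNS.
pose c := eta * (5 * S ^+ 2 * expR (4 / S * x)).
have c0 : 0 < c by rewrite !mulr_gt0 ?expR_gt0 ?exprn_gt0.
have C0 : 0 < `|C| + 1 by rewrite ltr_wpDl.
(* The first minimum gives [r <= 1] and [C * r ^+ 3 < c * r ^+ 2]; the second keeps the four
   neighbours inside the rectangle. *)
pose r := Num.min (Num.min 1 (c / (`|C| + 1) / 2)) (Num.min (X - `|x|) (S - `|y|)).
have r0 : 0 < r by rewrite !lt_min xX' yS' ltr01 !divr_gt0.
have r1 : r <= 1 by rewrite !ge_min lexx.
have rC : r <= c / (`|C| + 1) / 2 by rewrite !ge_min lexx orbT.
have rX : r <= X - `|x| by rewrite !ge_min lexx orbT.
have rS : r <= S - `|y| by rewrite !ge_min lexx !orbT.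
have := hC r (ltW r0) r1.
have := @barrier_submean S x y r S0 yS.
have in1 : K (x + r, y).
  by apply/KP; split=> //=; have := ler_normD x r; rewrite (gtr0_norm r0); lra.
have in2 : K (x - r, y).
  by apply/KP; split=> //=; have := ler_normB x r; rewrite (gtr0_norm r0); lra.
have in3 : K (x, y + r).
  by apply/KP; split=> //=; have := ler_normD y r; rewrite (gtr0_norm r0); lra.
have in4 : K (x, y - r).
  by apply/KP; split=> //=; have := ler_normB y r; rewrite (gtr0_norm r0); lra.
have := maxW _ (mem_set in1); have := maxW _ (mem_set in2).
have := maxW _ (mem_set in3); have := maxW _ (mem_set in4).
rewrite /W/=.
have Cr : C * r ^+ 3 < c * r ^+ 2.
  rewrite exprS mulrA ltr_pM2r ?exprn_gt0//.
  apply: (@le_lt_trans _ _ ((`|C| + 1) * r)).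
    by rewrite ler_wpM2r ?(ltW r0)// (le_trans (ler_norm _))// lerDl.
  apply: (@le_lt_trans _ _ (c / 2)); last lra.
  apply: le_trans (_ : (`|C| + 1) * (c / (`|C| + 1) / 2) <= _).
    by rewrite ler_wpM2l ?(ltW C0).
  by rewrite mulrA mulrCA divff ?gt_eqF// mulr1.
move=> m4 m3 m2 m1 /(ler_wpM2l (ltW eta0)); rewrite !mulrDr => bm sm.
have : eta * (5 * S ^+ 2 * r ^+ 2 * expR (4 / S * x)) = c * r ^+ 2 by rewrite /c; ring.
lra.
Qed.

End maximum_principle.

(** * The transform in a strip *)

Section real_integrals.
Context (d : measure_display) (T : measurableType d) (R : realType).
Variable m : {measure set T -> \bar R}.
Implicit Types f g : T -> R.

Definition Rintegrable f := m.-integrable setT (EFin \o f).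

Lemma Rintegrable_measurable f : Rintegrable f -> measurable_fun setT f.
Proof. by move=> /measurable_int/measurable_EFinP. Qed.

Lemma le_Rintegrable f g : measurable_fun setT f ->
  (forall t, `|f t| <= g t) -> Rintegrable g -> Rintegrable f.
Proof.
move=> mf fg; apply: le_integrable => //; first exact/measurable_EFinP.
by move=> t _ /=; rewrite lee_fin (le_trans (fg t))// ler_norm.
Qed.

Lemma RintegrableD f g :
  Rintegrable f -> Rintegrable g -> Rintegrable (fun t => f t + g t).
Proof. exact: integrableD. Qed.

Lemma RintegrableB f g :
  Rintegrable f -> Rintegrable g -> Rintegrable (fun t => f t - g t).
Proof. exact: integrableB. Qed.

Lemma RintegrableZ (c : R) f :
  Rintegrable f -> Rintegrable (fun t => c * f t).
Proof. exact: integrableZl. Qed.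

Lemma Rintegrable_norm f :
  Rintegrable f -> Rintegrable (fun t => `|f t|).
Proof. exact: integrable_norm. Qed.

Lemma norm_Rintegral_le f g : Rintegrable f -> Rintegrable g ->
  (forall t, `|f t| <= g t) -> `|\int[m]_t f t| <= \int[m]_t g t.
Proof.
move=> If Ig fg; apply: le_trans (le_normr_Rintegral _ If) _ => //.
by apply: le_Rintegral => //; exact: Rintegrable_norm.
Qed.

Lemma Rintegral_four f1 f2 f3 f4 g (c : R) :
  Rintegrable f1 -> Rintegrable f2 -> Rintegrable f3 -> Rintegrable f4 ->
  Rintegrable g ->
  \int[m]_t (f1 t + f2 t + f3 t + f4 t - c * g t) =
  \int[m]_t f1 t + \int[m]_t f2 t + \int[m]_t f3 t + \int[m]_t f4 t -
  c * \int[m]_t g t.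
Proof.
move=> i1 i2 i3 i4 ig.
have i12 := RintegrableD i1 i2; have i123 := RintegrableD i12 i3.
have i1234 := RintegrableD i123 i4; have icg := RintegrableZ c ig.
by rewrite RintegralB// RintegralD// RintegralD// RintegralD// RintegralZl.
Qed.

End real_integrals.

(** * Measurability and domination of the strip kernel *)

Section measurable_strip.
Variable R : realType.

Lemma measurable_strip_exp (y : R) :
  measurable_fun setT (fun a : R => expR (pi * (y ^+ 2 - a ^+ 2))).
Proof.
apply: measurableT_comp => //; apply: measurable_funM => //.
by apply: measurable_funB => //; exact: measurable_funX.
Qed.

Lemma measurable_strip_cos (y : R) : measurable_fun setT (fun a : R => strip_cos a y).
Proof.
apply: measurable_funM; first exact: measurable_strip_exp.
apply: (measurableT_comp (continuous_measurable_fun (@continuous_cos R))).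
by apply: measurable_funM => //; apply: measurable_funM.
Qed.

Lemma measurable_strip_sin (y : R) : measurable_fun setT (fun a : R => strip_sin a y).
Proof.
apply: measurable_funM; first exact: measurable_strip_exp.
apply: (measurableT_comp (continuous_measurable_fun (@continuous_sin R))).
by apply: measurable_funM => //; apply: measurable_funM.
Qed.

Lemma strip_exp_dom (a y : R) : expR (pi * (y ^+ 2 - a ^+ 2)) <= strip_dom a y.
Proof.
rewrite /strip_dom ler_peMl ?expR_ge0//.
have : 1 <= expR (4 * strip_rate a y).
  by rewrite -[leLHS]expR0 ler_expR; have := strip_rate_ge1 a y; lra.
lra.
Qed.

Lemma strip_cos_dom (a y : R) : `|strip_cos a y| <= strip_dom a y.
Proof.
apply: le_trans (strip_exp_dom _ _).
by rewrite normrM (ger0_norm (expR_ge0 _)) ler_piMr ?expR_ge0 ?cos_max.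
Qed.

Lemma strip_sin_dom (a y : R) : `|strip_sin a y| <= strip_dom a y.
Proof.
apply: le_trans (strip_exp_dom _ _).
by rewrite normrM (ger0_norm (expR_ge0 _)) ler_piMr ?expR_ge0 ?sin_max.
Qed.

Definition gauss_weight (c s : R) : R := expR (- pi * s ^+ 2 + c * `|s|).

Lemma gauss_weight_ge0 (c s : R) : 0 <= gauss_weight c s.
Proof. exact: expR_ge0. Qed.

(** The slope [c] collects [8 * pi] from [4 * strip_rate] and [2 * pi * |x|] from the cross term of
    [(s - x)^2]. Since [c] varies with [x], integrability will be required against every
    [gauss_weight]. *)
Lemma strip_dom_weight (x y : R) : exists K c : R, 0 <= K /\
  forall s, strip_dom (s - x) y <= K * gauss_weight c s.
Proof.
exists (26 * expR (8 * pi * (`|x| + `|y| + 1) + pi * y ^+ 2)).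
exists (8 * pi + 2 * pi * `|x|); split; first by rewrite mulr_ge0 ?expR_ge0.
move=> s; rewrite /strip_dom /gauss_weight -!mulrA ler_wpM2l// -!expRD ler_expR.
rewrite /strip_rate; have pi0 := pi_gt0 R.
have h1 : `|s - x| <= `|s| + `|x| by exact: ler_normB.
have h2 : s * x <= `|s| * `|x| by rewrite -normrM ler_norm.
have h3 : pi * `|s - x| <= pi * (`|s| + `|x|) by rewrite ler_wpM2l ?(ltW pi0).
have h4 : pi * (s * x) <= pi * (`|s| * `|x|) by rewrite ler_wpM2l ?(ltW pi0).
have h5 : 0 <= pi * (x * x) by rewrite mulr_ge0 ?(ltW pi0)// -expr2 sqr_ge0.
rewrite sqrrB; nra.
Qed.

End measurable_strip.

(** * Integrals against the strip kernel *)

Section strip_transform.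
Context (d : measure_display) (T : measurableType d) (R : realType).
Variable m : {measure set T -> \bar R}.
Variable tau : T -> R.
Hypothesis mtau : measurable_fun setT tau.

(** Real part of [(A + i B) (strip_cos - i strip_sin)]. The imaginary part is the same expression
    for the pair [(B, - A)], so each estimate is proved once. *)
Definition strip_int (A B : T -> R) (x y : R) (t : T) : R :=
  A t * strip_cos (tau t - x) y + B t * strip_sin (tau t - x) y.

Definition strip_transform A B x y : R := \int[m]_t strip_int A B x y t.

Definition weight_integrable (A : T -> R) :=
  measurable_fun setT A /\
  forall c : R, Rintegrable m (fun t => A t * gauss_weight c (tau t)).

Lemma weight_integrableN A :
  weight_integrable A -> weight_integrable (fun t => - A t).
Proof.
move=> [mA iA]; split=> [|c]; first exact: measurableT_comp.
have := RintegrableZ (-1) (iA c); apply: eq_integrable => // t _.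
by rewrite /=; congr EFin; ring.
Qed.

Variables A B : T -> R.
Hypotheses (iA : weight_integrable A) (iB : weight_integrable B).

Lemma weight_dom (K c : R) :
  Rintegrable m (fun t => K * (`|A t| + `|B t|) * gauss_weight c (tau t)).
Proof.
have := RintegrableZ K (RintegrableD (Rintegrable_norm (iA.2 c))
  (Rintegrable_norm (iB.2 c))).
apply: eq_integrable => // t _ /=; congr EFin.
by rewrite !normrM (ger0_norm (gauss_weight_ge0 _ _)); ring.
Qed.

Lemma measurable_strip_int x y : measurable_fun setT (strip_int A B x y).
Proof.
have mt : measurable_fun setT (fun t => tau t - x) by exact: measurable_funB.
apply: measurable_funD; apply: measurable_funM; rewrite ?(iA.1) ?(iB.1)//.
- exact: iA.1.
- exact: (measurableT_comp (measurable_strip_cos y) mt).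
- exact: iB.1.
- exact: (measurableT_comp (measurable_strip_sin y) mt).
Qed.

Lemma comb_le (a b u v D K w : R) : `|u| <= D -> `|v| <= D -> D <= K * w ->
  `|a * u + b * v| <= K * (`|a| + `|b|) * w.
Proof.
move=> uD vD DK; apply: le_trans (ler_normD _ _) _; rewrite !normrM.
have -> : K * (`|a| + `|b|) * w = `|a| * (K * w) + `|b| * (K * w) by ring.
by apply: lerD; rewrite ler_wpM2l//; exact: le_trans DK.
Qed.

Lemma strip_int_integrable x y : Rintegrable m (strip_int A B x y).
Proof.
have [K [c [K0 Kc]]] := strip_dom_weight x y.
apply: le_Rintegrable (weight_dom K c); first exact: measurable_strip_int.
by move=> t; apply: comb_le (strip_cos_dom _ _) (strip_sin_dom _ _) (Kc _).
Qed.

Lemma strip_transform_lip : locally_lipschitz2 (strip_transform A B).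
Proof.
move=> x y; have [K [c [K0 Kc]]] := strip_dom_weight x y.
exists (\int[m]_t (K * (`|A t| + `|B t|) * gauss_weight c (tau t))).
move=> h k r hr kr r1; have r0 : 0 <= r := le_trans (normr_ge0 _) hr.
rewrite /strip_transform -RintegralB//; [|exact: strip_int_integrable..].
rewrite -RintegralZr//; last exact: weight_dom.
apply: norm_Rintegral_le.
- by apply: RintegrableB; exact: strip_int_integrable.
- have := RintegrableZ r (weight_dom K c); apply: eq_integrable => // t _ /=.
  by congr EFin; rewrite mulrC.
move=> t; rewrite /strip_int.
have [|e1 e2] := @strip_lip _ (tau t - x) y (- h) k r _ kr r1.
  by rewrite normrN.
rewrite (_ : tau t - x - h = tau t - (x + h)) in e1 e2; last by ring.
set u := strip_cos _ _ - _ in e1; set v := strip_sin _ _ - _ in e2.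
rewrite (_ : _ - _ = A t * u + B t * v); last by rewrite /u /v; ring.
have Kr : strip_dom (tau t - x) y * r <= (r * K) * gauss_weight c (tau t).
  by rewrite mulrC -mulrA ler_wpM2l.
apply: le_trans (@comb_le (A t) (B t) u v _ _ _ e1 e2 Kr) _.
by rewrite le_eqVlt; apply/orP; left; apply/eqP; ring.
Qed.

Lemma strip_transform_four x y : exists C : R, forall r, 0 <= r -> r <= 1 ->
  `|strip_transform A B (x + r) y + strip_transform A B (x - r) y +
    strip_transform A B x (y + r) + strip_transform A B x (y - r) -
    4 * strip_transform A B x y| <= C * r ^+ 3.
Proof.
have [K [c [K0 Kc]]] := strip_dom_weight x y.
exists (\int[m]_t (K * (`|A t| + `|B t|) * gauss_weight c (tau t))).
move=> r r0 r1; have iS := strip_int_integrable.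
rewrite /strip_transform -Rintegral_four//.
rewrite -RintegralZr//; last exact: weight_dom.
apply: norm_Rintegral_le.
- by apply: RintegrableB; [do 3 apply: RintegrableD => //|exact: RintegrableZ].
- have := RintegrableZ (r ^+ 3) (weight_dom K c); apply: eq_integrable => // t _ /=.
  by congr EFin; rewrite mulrC.
move=> t; rewrite /strip_int.
have [e1 e2] := @strip_four_point _ (tau t - x) y r r0 r1.
rewrite (_ : tau t - x - r = tau t - (x + r)) in e1 e2; last by ring.
rewrite (_ : tau t - x + r = tau t - (x - r)) in e1 e2; last by ring.
set u := _ - 4 * strip_cos _ _ in e1; set v := _ - 4 * strip_sin _ _ in e2.
rewrite (_ : _ - 4 * _ = A t * u + B t * v); last by rewrite /u /v; ring.
have r3 : 0 <= r ^+ 3 by rewrite exprn_ge0.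
have Kr : strip_dom (tau t - x) y * r ^+ 3 <= (r ^+ 3 * K) * gauss_weight c (tau t).
  by rewrite mulrC -mulrA ler_wpM2l.
apply: le_trans (@comb_le (A t) (B t) u v _ _ _ e1 e2 Kr) _.
by rewrite le_eqVlt; apply/orP; left; apply/eqP; ring.
Qed.

End strip_transform.

(** * Moduli of complex numbers given by real and imaginary parts *)

Section modulus.
Variable R : realType.
Implicit Types a b c d : R.

Definition cabs a b : R := Num.sqrt (a ^+ 2 + b ^+ 2).

Lemma cabs_ge0 a b : 0 <= cabs a b. Proof. exact: sqrtr_ge0. Qed.

Lemma sqr_cabs a b : cabs a b ^+ 2 = a ^+ 2 + b ^+ 2.
Proof. by rewrite sqr_sqrtr// addr_ge0 ?sqr_ge0. Qed.

Lemma cabs_triangle a b c d : cabs (a + c) (b + d) <= cabs a b + cabs c d.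
Proof.
rewrite -(@ler_pXn2r _ 2)// ?nnegrE ?addr_ge0 ?cabs_ge0//.
rewrite sqrrD !sqr_cabs.
suff : a * c + b * d <= cabs a b * cabs c d by nra.
apply: le_trans (ler_norm _) _.
rewrite -(@ler_pXn2r _ 2)// ?nnegrE ?mulr_ge0 ?cabs_ge0//.
rewrite real_normK ?num_real// exprMn !sqr_cabs.
have := sqr_ge0 (a * d - b * c); nra.
Qed.

Lemma cabs_le a b : cabs a b <= `|a| + `|b|.
Proof.
rewrite -(@ler_pXn2r _ 2)// ?nnegrE ?addr_ge0 ?cabs_ge0//.
rewrite sqr_cabs sqrrD !real_normK ?num_real//.
have : 0 <= `|a| * `|b| by rewrite mulr_ge0.
lra.
Qed.

Lemma cabsZ k a b : 0 <= k -> cabs (k * a) (k * b) = k * cabs a b.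
Proof.
by move=> k0; rewrite /cabs !exprMn -mulrDr sqrtrM ?sqr_ge0// sqrtr_sqr ger0_norm.
Qed.

Lemma cabs_rotate (th a b : R) :
  cabs (a * cos th + b * sin th) (b * cos th - a * sin th) = cabs a b.
Proof.
rewrite /cabs; congr Num.sqrt; have := cos2Dsin2 th => h.
transitivity ((a ^+ 2 + b ^+ 2) * (cos th ^+ 2 + sin th ^+ 2)); first by ring.
by rewrite h mulr1.
Qed.

End modulus.

(** * The maximum principle applied to the modulus of the transform *)

Section strip_abs.
Context (d : measure_display) (T : measurableType d) (R : realType).
Variable m : {measure set T -> \bar R}.
Variable tau : T -> R.
Hypothesis mtau : measurable_fun setT tau.
Variables A B : T -> R.
Hypotheses (iA : weight_integrable m tau A) (iB : weight_integrable m tau B).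
Let NA t := - A t.
Let iNA : weight_integrable m tau NA := weight_integrableN iA.

Definition strip_abs x y : R :=
  cabs (strip_transform m tau A B x y)
       (strip_transform m tau B (fun t => - A t) x y).

Lemma strip_abs_lip : locally_lipschitz2 strip_abs.
Proof.
move=> x y; have [C1 h1] := strip_transform_lip mtau iA iB x y.
have [C2 h2] := strip_transform_lip mtau iB iNA x y.
exists (C1 + C2) => h k r hr kr r1.
have {}h1 := h1 _ _ _ hr kr r1; have {}h2 := h2 _ _ _ hr kr r1.
rewrite /strip_abs -/NA.
set a' := strip_transform _ _ A B (x + h) _ in h1 *.
set b' := strip_transform _ _ B _ (x + h) _ in h2 *.
set a := strip_transform _ _ A B x _ in h1 *.
set b := strip_transform _ _ B _ x _ in h2 *.
have t1 := cabs_triangle a b (a' - a) (b' - b).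
have t2 := cabs_triangle a' b' (a - a') (b - b').
have l1 := cabs_le (a' - a) (b' - b).
have l2 := cabs_le (a - a') (b - b').
rewrite !(addrC _ (_ - _)) !subrK in t1 t2.
rewrite (distrC a) (distrC b) in l2.
by rewrite mulrDl ler_norml; apply/andP; split; lra.
Qed.

(** The triangle inequality for [4 G], written as the sum of the four neighbouring values plus the
    cubic error. *)
Lemma strip_abs_submean : almost_submean strip_abs.
Proof.
move=> x y; have [C1 h1] := strip_transform_four mtau iA iB x y.
have [C2 h2] := strip_transform_four mtau iB iNA x y.
exists (C1 + C2) => r r0 r1.
have {}h1 := h1 _ r0 r1; have {}h2 := h2 _ r0 r1.
rewrite /strip_abs -/NA.
set a1 := strip_transform _ _ A B (x + r) y in h1 *.
set a2 := strip_transform _ _ A B (x - r) y in h1 *.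
set a3 := strip_transform _ _ A B x (y + r) in h1 *.
set a4 := strip_transform _ _ A B x (y - r) in h1 *.
set a := strip_transform _ _ A B x y in h1 *.
set b1 := strip_transform _ _ B _ (x + r) y in h2 *.
set b2 := strip_transform _ _ B _ (x - r) y in h2 *.
set b3 := strip_transform _ _ B _ x (y + r) in h2 *.
set b4 := strip_transform _ _ B _ x (y - r) in h2 *.
set b := strip_transform _ _ B _ x y in h2 *.
rewrite -(cabsZ a b (ler0n R 4)).
have t0 := cabs_triangle (a1 + a2 + a3 + a4) (b1 + b2 + b3 + b4)
  (4 * a - (a1 + a2 + a3 + a4)) (4 * b - (b1 + b2 + b3 + b4)).
rewrite !subrKC in t0.
have := cabs_le (4 * a - (a1 + a2 + a3 + a4)) (4 * b - (b1 + b2 + b3 + b4)).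
rewrite (distrC (4 * a)) (distrC (4 * b)) => l0.
have t1 := cabs_triangle (a1 + a2 + a3) (b1 + b2 + b3) a4 b4.
have t2 := cabs_triangle (a1 + a2) (b1 + b2) a3 b3.
have t3 := cabs_triangle a1 b1 a2 b2.
have := mulrDl C1 C2 (r ^+ 3); lra.
Qed.

Lemma gauss_shift_integrable x : Rintegrable m
  (fun t => (`|A t| + `|B t|) * expR (- pi * (tau t - x) ^+ 2)).
Proof.
have [K [c [K0 Kc]]] := strip_dom_weight x 0.
apply: le_Rintegrable (weight_dom iA iB K c) => [|t].
  apply: measurable_funM.
    by apply: measurable_funD; apply: measurableT_comp => //; [exact: iA.1|exact: iB.1].
  apply: measurableT_comp => //; apply: measurable_funM => //.
  by apply: measurable_funX; exact: measurable_funB.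
rewrite normrM (ger0_norm (expR_ge0 _)) ger0_norm ?addr_ge0//.
rewrite -[leRHS]mulrA [leRHS]mulrCA ler_wpM2l ?addr_ge0//.
apply: le_trans (Kc (tau t)); apply: le_trans (strip_exp_dom _ _).
by rewrite expr0n/= sub0r mulrN mulNr.
Qed.

Lemma strip_abs_bound x y : strip_abs x y <= 2 * expR (pi * y ^+ 2) *
  \int[m]_t ((`|A t| + `|B t|) * expR (- pi * (tau t - x) ^+ 2)).
Proof.
have key (A' B' : T -> R) : weight_integrable m tau A' -> weight_integrable m tau B' ->
    (forall t, `|A' t| + `|B' t| = `|A t| + `|B t|) ->
    `|strip_transform m tau A' B' x y| <= expR (pi * y ^+ 2) *
    \int[m]_t ((`|A t| + `|B t|) * expR (- pi * (tau t - x) ^+ 2)).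
  move=> iA' iB' AB; rewrite -RintegralZl//; last exact: gauss_shift_integrable.
  apply: norm_Rintegral_le; first exact: strip_int_integrable.
    exact: RintegrableZ (gauss_shift_integrable x).
  move=> t; rewrite -AB.
  have E : expR (pi * (y ^+ 2 - (tau t - x) ^+ 2)) =
    expR (pi * y ^+ 2) * expR (- pi * (tau t - x) ^+ 2).
    by rewrite -expRD; congr expR; ring.
  have := @comb_le R (A' t) (B' t) (strip_cos (tau t - x) y)
    (strip_sin (tau t - x) y) (expR (pi * (y ^+ 2 - (tau t - x) ^+ 2)))
    (expR (pi * y ^+ 2)) (expR (- pi * (tau t - x) ^+ 2)).
  rewrite -mulrA; apply; rewrite ?E//.
  - by rewrite -E normrM (ger0_norm (expR_ge0 _)) ler_piMr ?expR_ge0 ?cos_max.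
  - by rewrite -E normrM (ger0_norm (expR_ge0 _)) ler_piMr ?expR_ge0 ?sin_max.
apply: le_trans (cabs_le _ _) _.
rewrite -mulrA mulr_natl mulr2n lerD// key// => t.
by rewrite normrN addrC.
Qed.

Lemma strip_center_lt (S M m0 : R) : 0 < S ->
  (forall x, strip_abs x S <= M) -> (forall x, strip_abs x (- S) <= M) ->
  (forall e : R, 0 < e -> exists n : nat, forall s : R, `|s| = n.+1%:R ->
    \int[m]_t ((`|A t| + `|B t|) * expR (- pi * (tau t - s) ^+ 2)) <= e) ->
  0 < m0 -> M <= m0 -> strip_abs 0 0 < m0.
Proof.
move=> S0 MS MNS dec m00 Mm0.
pose E := 2 * expR (pi * S ^+ 2).
have E0 : 0 < E by rewrite mulr_gt0 ?expR_gt0.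
(* The half-length [X] is fixed first, so that the vertical sides use up only half of [m0]. *)
have [|n hn] := dec (m0 / 2 / E); first by rewrite !divr_gt0.
pose X : R := n.+1%:R; have X0 : 0 < X by rewrite ltr0n.
have V s y : `|s| = X -> `|y| <= S -> strip_abs s y <= m0 / 2.
  move=> sX yS; apply: le_trans (strip_abs_bound s y) _.
  apply: le_trans (_ : E * (m0 / 2 / E) <= _); last by rewrite mulrCA divff ?gt_eqF// mulr1.
  apply: ler_pM; [by rewrite mulr_ge0 ?expR_ge0| |  |exact: hn].
    by apply: Rintegral_ge0 => t _; rewrite mulr_ge0 ?expR_ge0// addr_ge0.
  rewrite ler_wpM2l// ler_expR ler_wpM2l ?pi_ge0//.
  by rewrite -[y ^+ 2]real_normK ?num_real// lerXn2r// nnegrE// ltW.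
pose b := expR (4 / S * X) * S ^+ 4.
have b0 : 0 < b by rewrite mulr_gt0 ?expR_gt0 ?exprn_gt0.
(* With this weight the barrier is at most [m0 / 2] on the vertical sides, which brings the total
   there to [m0]; its positive value at the centre makes the inequality strict. *)
have eta0 : 0 < m0 / 2 / b by rewrite !divr_gt0.
have := @strip_maximum _ strip_abs S X M (m0 / 2) (m0 / 2 / b) strip_abs_lip
  strip_abs_submean S0 X0 eta0 (fun x _ => MS x) (fun x _ => MNS x).
have nX : `|X| = X by rewrite gtr0_norm.
have nNX : `|- X| = X by rewrite normrN.
move=> /(_ (fun y => V X y nX) (fun y => V (- X) y nNX)) h.
suff : m0 / 2 / b * S ^+ 4 > 0 /\ Num.max M (m0 / 2 + m0 / 2 / b * b) <= m0.
  move=> [p1 p2]; have := le_trans h p2; lra.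
split; first by rewrite mulr_gt0 ?exprn_gt0.
by rewrite ge_max Mm0 divfK ?gt_eqF//=; lra.
Qed.

End strip_abs.

(** * Vanishing integrals *)

Section vanishing_integrals.
Context (d : measure_display) (T : measurableType d) (R : realType).
Variable m : {measure set T -> \bar R}.

Lemma Rintegral_limit0 (f_ : nat -> T -> R) (f g : T -> R) :
  (forall n, measurable_fun setT (f_ n)) -> measurable_fun setT f ->
  (forall t, f_ n t @[n --> \oo] --> f t) ->
  Rintegrable m g -> (forall n t, `|f_ n t| <= g t) ->
  (forall n, \int[m]_t f_ n t = 0) -> \int[m]_t f t = 0.
Proof.
move=> mf_ mf f_f ig f_g f_0.
have [] := @dominated_convergence _ _ _ m setT measurableT
  (fun n => EFin \o f_ n) (EFin \o f) (EFin \o g).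
- by move=> n; exact/measurable_EFinP.
- exact/measurable_EFinP.
- by apply: aeW => t _; apply/cvg_EFin; [exact: nearW|exact: f_f].
- exact: ig.
- by apply: aeW => t n _ /=; rewrite lee_fin.
move=> _ _ cv; rewrite /Rintegral.
(* [fine] sends infinite values to 0 as well, so a vanishing real integral gives a vanishing
   extended one only through integrability. *)
have : (fun n => (\int[m]_t (f_ n t)%:E)%E) = (fun=> 0%E).
  apply/funext => n; rewrite -[LHS]fineK; first by rewrite (f_0 n : fine _ = 0).
  apply: integrable_fin_num => //; apply: le_Rintegrable ig => //.
move=> e; rewrite /= e in cv.
by have := cvg_unique _ cv (cvg_cst (0 : \bar R)%E) => ->.
Qed.

Variable F : T -> R.
Hypothesis iF : Rintegrable m F.

Lemma Rintegrable_indic A : measurable A -> Rintegrable m (fun t => F t * \1_A t).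
Proof.
move=> mA; apply: le_Rintegrable (Rintegrable_norm iF) => [|t].
  by apply: measurable_funM => //; exact: Rintegrable_measurable iF.
rewrite normrM ler_piMr// indicE; case: (_ \in _); by rewrite ?normr1 ?normr0.
Qed.

(** Dynkin's argument: the measurable sets over which [F] has integral zero form a lambda-system.
    The hypothesis on [\int F] puts the whole space into it, as [G] need not contain it. *)
Lemma integral_pi_lambda (G : set (set T)) : setI_closed G ->
  (forall A, G A -> measurable A /\ \int[m]_t (F t * \1_A t) = 0) ->
  \int[m]_t F t = 0 ->
  forall A, <<s G >> A -> measurable A /\ \int[m]_t (F t * \1_A t) = 0.
Proof.
move=> GI G0 F0.
pose H := [set A | measurable A /\ \int[m]_t (F t * \1_A t) = 0].
suff : <<s G >> `<=` H by move=> GH A /GH.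
apply: lambda_system_subset => //; split=> //=.
- split=> //; rewrite -[RHS]F0; apply: eq_Rintegral => t _.
  by rewrite indicT mulr1.
- move=> B A AB [mB B0] [mA A0]; split; first exact: measurableD.
  transitivity (\int[m]_t (F t * \1_B t - F t * \1_A t)); last first.
    by rewrite RintegralB ?A0 ?B0 ?subrr//; exact: Rintegrable_indic.
  apply: eq_Rintegral => t _; rewrite -mulrBr; congr (_ * _).
  rewrite !indicE in_setD; have [tA|_] := boolP (t \in A).
    by rewrite (mem_set (AB _ (set_mem tA))) subrr.
  by rewrite andbT subr0.
- move=> B ndB HB; split; first by apply: bigcupT_measurable => n; have [] := HB n.
  apply: (@Rintegral_limit0 (fun n t => F t * \1_(B n) t) _ (fun t => `|F t|)).
  + by move=> n; apply: Rintegrable_measurable; apply: Rintegrable_indic; have [] := HB n.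
  + apply: Rintegrable_measurable; apply: Rintegrable_indic.
    by apply: bigcupT_measurable => n; have [] := HB n.
  + move=> t; have [[k _ Bkt]|nB] := pselect ((\bigcup_i B i) t).
      apply: cvg_near_cst.
      exists k => // n /= kn; rewrite !indicE !mem_set//; first by exists k.
      by move/subsetPset : (ndB _ _ kn); apply.
    apply: cvg_near_cst.
    apply: nearW => n; rewrite !indicE !memNset// => Bnt; apply: nB.
    by exists n.
  + exact: Rintegrable_norm.
  + move=> n t; rewrite normrM ler_piMr// indicE; case: (_ \in _); by rewrite ?normr1 ?normr0.
  + by move=> n; have [] := HB n.
Qed.

Lemma integral_eq0_ae :
  (forall A, measurable A -> \int[m]_t (F t * \1_A t) = 0) ->
  {ae m, forall t, F t = 0}.
Proof.
move=> F0.
have : ae_eq m setT (EFin \o F) (cst 0%E).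
  apply: integral_ae_eq => // E _ mE.
  rewrite integral0 integral_mkcond.
  have e := congr1 EFin (F0 E mE); rewrite /Rintegral fineK in e; last first.
    exact: (integrable_fin_num _ (Rintegrable_indic mE)).
  rewrite -[RHS]e; apply: eq_integral => t _.
  rewrite patchE indicE; case: ifPn => /= _; by rewrite ?mulr1 ?mulr0.
apply: filterS => t /(_ I)/= [] //.
Qed.

End vanishing_integrals.

Lemma measurable_closed_itv (R : realType) (A : set R) : measurable A ->
  <<s [set B : set R | exists a b, B = `[a, b]%classic] >> A.
Proof.
move=> mA.
have mA' : (@ocitv R).-sigma.-measurable A := mA.
rewrite RGenCInfty.measurableE in mA'; move: A mA' {mA}.
apply: smallest_sub; first exact: smallest_sigma_algebra.
move=> _ [x ->].
have -> : `[x, +oo[%classic = \bigcup_n `[x, n%:R]%classic.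
  apply/seteqP; split=> [y|y [n _]]; last first.
    by rewrite /= !in_itv/= andbT => /andP[].
  rewrite itvbndyEbigcup => -[n _]; rewrite /= in_itv/= => /andP[xy yn].
  by exists n => //=; rewrite in_itv/= xy ltW.
apply: sigma_algebra_bigcup => n; apply: sub_sigma_algebra.
by exists x, n%:R.
Qed.

(** * Uniqueness for two-sided Laplace transforms *)

Section laplace_uniqueness.
Context (d : measure_display) (T : measurableType d) (R : realType).
Variable m : {measure set T -> \bar R}.
Variable X : T -> R.
Hypothesis mX : measurable_fun setT X.
Variable c : R.
Hypothesis c0 : 0 < c.

(** The Gaussian factor in the integrability condition is a reserve of decay. Multiplying [W] by a
    decaying Gaussian preserves it with the same [c], which makes iteration possible. *)
Definition laplace_null (W : T -> R) := [/\ measurable_fun setT W,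
  Rintegrable m (fun t => W t * expR (c * X t ^+ 2)) &
  forall x, \int[m]_t (W t * expR (x * X t)) = 0].

Lemma poly_exp_dom (k : nat) (a : R) : exists2 K : R, 0 <= K &
  forall s : R, `|s| ^+ k * expR (a * `|s|) <= K * expR (c / 2 * s ^+ 2).
Proof.
exists (expR ((k%:R + a) ^+ 2 / (2 * c))); first exact: expR_ge0.
move=> s; apply: (@le_trans _ _ (expR ((k%:R + a) * `|s|))).
  rewrite mulrDl expRD ler_wpM2r ?expR_ge0// expRM_natl.
  rewrite lerXn2r ?nnegrE ?expR_ge0//.
  by have := expR_ge1Dx `|s|; lra.
rewrite -expRD ler_expR -[s ^+ 2]real_normK ?num_real//.
set u := k%:R + a; set v := `|s|.
rewrite -subr_ge0.
have -> : u ^+ 2 / (2 * c) + c / 2 * v ^+ 2 - u * v = (u - c * v) ^+ 2 / (2 * c).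
  by field; rewrite gt_eqF.
by rewrite divr_ge0 ?sqr_ge0// mulr_ge0// ltW.
Qed.

(** The reserve is split in half: one half pays for the power and the exponential through
    [poly_exp_dom], the other allows [h] to grow like [expR (c / 2 * X t ^+ 2)]. *)
Lemma laplace_null_integrable W (h : T -> R) (k : nat) (a : R) :
  laplace_null W -> measurable_fun setT h ->
  (forall t, `|h t| <= `|X t| ^+ k * expR (a * `|X t|) * expR (c / 2 * X t ^+ 2)) ->
  Rintegrable m (fun t => W t * h t).
Proof.
move=> [mW iW _] mh hb; have [K K0 hK] := poly_exp_dom k a.
apply: le_Rintegrable (RintegrableZ K (Rintegrable_norm iW)) => [|t].
  exact: measurable_funM.
rewrite !normrM (ger0_norm (expR_ge0 _)) mulrCA ler_wpM2l//.
apply: le_trans (hb t) _.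
have -> : c * X t ^+ 2 = c / 2 * X t ^+ 2 + c / 2 * X t ^+ 2 by field.
by rewrite expRD [leRHS]mulrA ler_wpM2r ?expR_ge0.
Qed.

Lemma expR_norm_le (x s : R) : expR (x * s) <= expR (`|x| * `|s|).
Proof. by rewrite ler_expR -normrM ler_norm. Qed.

Lemma measurable_laplace_monomial (k : nat) (x : R) :
  measurable_fun setT (fun t => X t ^+ k * expR (x * X t)).
Proof.
apply: measurable_funM; first exact: measurable_funX.
by apply: measurableT_comp => //; exact: measurable_funM.
Qed.

Lemma expR_sqr_ge1 (s : R) : 1 <= expR (c / 2 * s ^+ 2).
Proof. by rewrite -[leLHS]expR0 ler_expR mulr_ge0 ?sqr_ge0 ?divr_ge0 ?(ltW c0). Qed.

Lemma laplace_monomial_integrable W (k : nat) (x : R) : laplace_null W ->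
  Rintegrable m (fun t => W t * (X t ^+ k * expR (x * X t))).
Proof.
move=> hW; apply: (@laplace_null_integrable W _ k `|x|) => //.
  exact: measurable_laplace_monomial.
move=> t; rewrite normrM normrX (ger0_norm (expR_ge0 _)).
apply: (@le_trans _ _ (`|X t| ^+ k * expR (`|x| * `|X t|))).
  by rewrite ler_wpM2l ?exprn_ge0// expR_norm_le.
by rewrite ler_peMr ?expR_sqr_ge1// mulr_ge0 ?exprn_ge0 ?expR_ge0.
Qed.

Lemma eq0_of_small (I C : R) :
  (forall h : R, 0 < h -> h <= 1 -> `|I| <= h * C) -> I = 0.
Proof.
move=> hC; apply/eqP; rewrite -normr_le0 leNgt; apply/negP => I0.
have C0 : 0 < `|C| + 1 by rewrite ltr_wpDl.
pose h := Num.min 1 (`|I| / (`|C| + 1) / 2).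
have h0 : 0 < h by rewrite lt_min ltr01 !divr_gt0.
have h1 : h <= 1 by rewrite ge_min lexx.
have := hC h h0 h1; apply/negP; rewrite -ltNge.
apply: (@le_lt_trans _ _ (`|I| / 2)); last by lra.
apply: (@le_trans _ _ (h * (`|C| + 1))).
  by rewrite ler_wpM2l ?(ltW h0)// (le_trans (ler_norm _))// lerDl.
rewrite -ler_pdivlMr// (_ : `|I| / 2 / _ = `|I| / (`|C| + 1) / 2).
  by rewrite ge_min lexx orbT.
by rewrite mulrAC.
Qed.

Lemma laplace_moment W (k : nat) (x : R) : laplace_null W ->
  \int[m]_t (W t * (X t ^+ k * expR (x * X t))) = 0.
Proof.
move=> hW; elim: k x => [|k IH] x.
  have [_ _ h0] := hW; rewrite -[RHS](h0 x); apply: eq_Rintegral => t _.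
  by rewrite expr0 mul1r.
have iM := laplace_monomial_integrable _ _ hW.
pose g t := `|W t| * (`|X t| ^+ k.+2 * expR ((`|x| + 1) * `|X t|)).
have pos t : 0 <= `|X t| ^+ k.+2 * expR ((`|x| + 1) * `|X t|).
  by apply: mulr_ge0; [exact: exprn_ge0|exact: expR_ge0].
have ig : Rintegrable m g.
  have : Rintegrable m (fun t => W t * (`|X t| ^+ k.+2 * expR ((`|x| + 1) * `|X t|))).
    apply: (@laplace_null_integrable W _ k.+2 (`|x| + 1)) => //.
      apply: measurable_funM; first by apply: measurable_funX; exact: measurableT_comp.
      by apply: measurableT_comp => //; apply: measurable_funM => //; exact: measurableT_comp.
    by move=> t; rewrite ger0_norm// ler_peMr ?expR_sqr_ge1.
  move=> /Rintegrable_norm; apply: eq_integrable => // t _.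
  apply: (congr1 EFin); rewrite normrM; congr (_ * _).
  by rewrite ger0_norm.
apply: (@eq0_of_small _ (\int[m]_t g t)) => h h0 h1.
set I := Rintegral _ _ _.
have i1 := RintegrableZ h (iM k.+1 x).
have i2 := iM k (x + h); have i3 := iM k x; have i12 := RintegrableB i1 i2.
(* The two added integrals vanish by the induction hypothesis, at [x + h] and at [x]; what remains
   is a Taylor remainder of order [h ^+ 2]. *)
have hI : h * I = \int[m]_t (h * (W t * (X t ^+ k.+1 * expR (x * X t)))
  - W t * (X t ^+ k * expR ((x + h) * X t)) + W t * (X t ^+ k * expR (x * X t))).
  rewrite [RHS](RintegralD measurableT i12 i3).
  rewrite [X in _ = X + _](RintegralB measurableT i1 i2).
  rewrite [X in _ = _ + X]IH addr0 [X in _ = _ - X]IH subr0.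
  exact: (esym (RintegralZl h measurableT (iM k.+1 x))).
rewrite -(ler_pM2l h0) -[X in X * `|_|](gtr0_norm h0) -normrM hI mulrA -RintegralZl//.
apply: norm_Rintegral_le.
- exact: RintegrableD i12 i3.
- exact: RintegrableZ.
move=> t; rewrite /g.
have -> : h * (W t * (X t ^+ k.+1 * expR (x * X t)))
  - W t * (X t ^+ k * expR ((x + h) * X t)) + W t * (X t ^+ k * expR (x * X t))
  = - (W t * (X t ^+ k * (expR (x * X t) * (expR (h * X t) - 1 - h * X t)))).
  by rewrite (mulrDl x h) expRD exprS; ring.
rewrite normrN !normrM normrX (ger0_norm (expR_ge0 _)).
rewrite [leRHS]mulrCA ler_wpM2l//.
have -> : h * h * (`|X t| ^+ k.+2 * expR ((`|x| + 1) * `|X t|)) =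
  `|X t| ^+ k * (expR (`|x| * `|X t|) * ((h * `|X t|) ^+ 2 * expR `|X t|)).
  by rewrite (mulrDl `|x| 1) mul1r expRD !exprS; ring.
rewrite ler_wpM2l ?exprn_ge0// ler_pM ?expR_ge0 ?expR_norm_le//.
apply: le_trans (expR_taylor1 _) _.
rewrite normrM (gtr0_norm h0) ler_wpM2l ?exprn_ge0 ?mulr_ge0 ?(ltW h0)// ler_expR.
by rewrite ler_piMl.
Qed.

Lemma expR_series_bound (y : R) n : `|series (exp_coeff y) n| <= expR `|y|.
Proof.
apply: (@le_trans _ _ (series (exp_coeff `|y|) n)).
  rewrite /series/= (le_trans (ler_norm_sum _ _ _))// ler_sum// => i _.
  by rewrite /exp_coeff/= normrM normrX (ger0_norm (_ : 0 <= (i`!%:R)^-1)).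
apply: nondecreasing_cvgn_le; last exact: is_cvg_series_exp_coeff.
by apply: nondecreasing_series => i _ _; exact: exp_coeff_ge0.
Qed.

(** Expand the new Gaussian in its exponential series: each partial sum pairs to zero because the
    moments do, and all are dominated by [expR (c / 2 * X t ^+ 2)], exactly the half of the reserve
    left free. This fixes the exponent [c / 2]. *)
Lemma laplace_null_gauss W : laplace_null W ->
  laplace_null (fun t => W t * expR (- (c / 2) * X t ^+ 2)).
Proof.
move=> hW; have [mW iW h0] := hW.
have mG : measurable_fun setT (fun t => expR (- (c / 2) * X t ^+ 2)).
  by apply: measurableT_comp => //; apply: measurable_funM => //; exact: measurable_funX.
have mW' : measurable_fun setT (fun t => W t * expR (- (c / 2) * X t ^+ 2)).
  exact: measurable_funM.
split=> //.
  apply: le_Rintegrable (Rintegrable_norm iW) => [|t].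
    apply: measurable_funM => //; apply: measurableT_comp => //.
    by apply: measurable_funM => //; exact: measurable_funX.
  rewrite !normrM !(ger0_norm (expR_ge0 _)) ler_wpM2r ?expR_ge0// ler_piMr//.
  rewrite -[leRHS]expR0 ler_expR mulNr oppr_le0.
  by rewrite mulr_ge0 ?sqr_ge0 ?divr_ge0 ?(ltW c0).
move=> x; have mE : measurable_fun setT (fun t => expR (x * X t)).
  by apply: measurableT_comp => //; exact: measurable_funM.
pose S n t := series (exp_coeff (- (c / 2) * X t ^+ 2)) n.
have iM := laplace_monomial_integrable _ _ hW.
have key n : Rintegrable m (fun t => W t * (S n t * expR (x * X t))) /\
    \int[m]_t (W t * (S n t * expR (x * X t))) = 0.
  elim: n => [|n [iS S0]].
    have S0E t : W t * (S 0 t * expR (x * X t)) = 0.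
      by rewrite /S /series/= big_geq// mul0r mulr0.
    split; last first.
      transitivity (\int[m]_t (0 : R)); first by apply: eq_Rintegral => t _; rewrite S0E.
      by rewrite Rintegral_cst// mul0r.
    by apply: (eq_integrable measurableT (cst 0%E)) => [t _|]; [rewrite /= S0E|exact: integrable0].
  pose k := (- (c / 2)) ^+ n / n`!%:R.
  have SE t : W t * (S n.+1 t * expR (x * X t)) =
     W t * (S n t * expR (x * X t)) + k * (W t * (X t ^+ (2 * n) * expR (x * X t))).
    rewrite /S seriesSr /exp_coeff/= exprMn -exprM /k; ring.
  have iZ := RintegrableZ k (iM (2 * n)%N x).
  split.
    have := RintegrableD iS iZ; apply: eq_integrable => // t _ /=.
    by rewrite SE.
  transitivity (\int[m]_t (W t * (S n t * expR (x * X t)) +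
      k * (W t * (X t ^+ (2 * n) * expR (x * X t))))).
    by apply: eq_Rintegral => t _; rewrite SE.
  rewrite (RintegralD measurableT iS iZ) S0 add0r.
  rewrite [LHS](RintegralZl _ measurableT (iM (2 * n)%N x)).
  by rewrite [X in _ * X](laplace_moment _ _ hW) mulr0.
apply: (@Rintegral_limit0 _ _ _ m (fun n t => W t * (S n t * expR (x * X t))) _
  (fun t => `|W t * (expR (x * X t) * expR (c / 2 * X t ^+ 2))|)).
- by move=> n; exact: Rintegrable_measurable (key n).1.
- exact: measurable_funM.
- move=> t; rewrite -mulrA; apply: cvgM; first exact: cvg_cst.
  apply: cvgM; last exact: cvg_cst.
  exact: is_cvg_series_exp_coeff.
- apply: Rintegrable_norm; apply: (@laplace_null_integrable W _ 0 `|x|) => //.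
    apply: measurable_funM => //; apply: measurableT_comp => //.
    by apply: measurable_funM => //; exact: measurable_funX.
  move=> t; rewrite expr0 mul1r normrM !(ger0_norm (expR_ge0 _)).
  by rewrite ler_wpM2r ?expR_ge0 ?expR_norm_le.
- move=> n t; rewrite !normrM ler_wpM2l// (ger0_norm (expR_ge0 _)) mulrC ler_wpM2l ?expR_ge0//.
  rewrite (ger0_norm (expR_ge0 _)) (le_trans (expR_series_bound _ _))// ler_expR.
  by rewrite mulNr normrN ger0_norm// mulr_ge0 ?sqr_ge0 ?divr_ge0 ?(ltW c0).
- by move=> n; exact: (key n).2.
Qed.

Lemma laplace_null_iter W n : laplace_null W ->
  laplace_null (fun t => W t * expR (- (c / 2) * X t ^+ 2) ^+ n).
Proof.
move=> hW; elim: n => [|n IH].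
  by rewrite (_ : (fun t => _) = W)//; apply/funext => t; rewrite expr0 mulr1.
have := laplace_null_gauss IH.
rewrite (_ : (fun t => _) = (fun t => W t * expR (- (c / 2) * X t ^+ 2) ^+ n.+1))//.
by apply/funext => t; rewrite [_ ^+ n.+1]exprSr mulrA.
Qed.

(** Expanding the square turns the [j]-th power into a constant times
    [expR (- (c / 2) * X t ^+ 2) ^+ j] times an exponential in [X t], whose integral against [W] is
    a Laplace integral of the [j]-fold iterate. *)
Definition bump (s A : R) (t : T) : R := A * expR (- (c / 2) * (X t - s) ^+ 2).

Lemma bump_power W s A j : laplace_null W ->
  Rintegrable m (fun t => W t * bump s A t ^+ j) /\
  \int[m]_t (W t * bump s A t ^+ j) = 0.
Proof.
move=> hW; have hj := laplace_null_iter j hW.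
have iM := laplace_monomial_integrable 0 (j%:R * (c * s)) hj.
pose K := (A * expR (- (c / 2) * s ^+ 2)) ^+ j.
have E t : W t * bump s A t ^+ j = K * (W t * expR (- (c / 2) * X t ^+ 2) ^+ j *
    (X t ^+ 0 * expR (j%:R * (c * s) * X t))).
  have -> : bump s A t = A * expR (- (c / 2) * s ^+ 2) *
      (expR (- (c / 2) * X t ^+ 2) * expR (c * s * X t)).
    by rewrite /bump -[RHS]mulrA -!expRD; congr (_ * expR _); field.
  by rewrite !exprMn -mulrA -(mulrA j%:R) expRM_natl /K exprMn expr0; ring.
split.
  have := RintegrableZ K iM; apply: eq_integrable => // t _.
  by apply: (congr1 EFin); rewrite E.
transitivity (\int[m]_t (K * (W t * expR (- (c / 2) * X t ^+ 2) ^+ j *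
    (X t ^+ 0 * expR (j%:R * (c * s) * X t))))).
  by apply: eq_Rintegral => t _; rewrite E.
rewrite [LHS](RintegralZl _ measurableT iM).
by rewrite [X in _ * X](laplace_moment _ _ hj) mulr0.
Qed.

(** The factor [bump ^+ j] is there for the induction on [N], which splits off one factor
    [1 - bump ^+ n] and shifts [j] by [n]. *)
Lemma bump_polynomial W s A n N j : laplace_null W ->
  Rintegrable m (fun t => W t * ((1 - bump s A t ^+ n) ^+ N * bump s A t ^+ j)) /\
  \int[m]_t (W t * ((1 - bump s A t ^+ n) ^+ N * bump s A t ^+ j)) = 0.
Proof.
move=> hW; elim: N j => [|N IH] j.
  have [i0 e0] := bump_power s A j hW.
  split; first by move: i0; apply: eq_integrable => // t _; rewrite /= expr0 mul1r.
  by rewrite -[RHS]e0; apply: eq_Rintegral => t _; rewrite expr0 mul1r.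
have [i1 e1] := IH j; have [i2 e2] := IH (n + j)%N.
have E t : W t * ((1 - bump s A t ^+ n) ^+ N.+1 * bump s A t ^+ j) =
  W t * ((1 - bump s A t ^+ n) ^+ N * bump s A t ^+ j) -
  W t * ((1 - bump s A t ^+ n) ^+ N * bump s A t ^+ (n + j)).
  by rewrite [_ ^+ N.+1]exprSr exprD; ring.
split.
  have := RintegrableB i1 i2; apply: eq_integrable => // t _.
  by apply: (congr1 EFin); rewrite E.
transitivity (\int[m]_t (W t * ((1 - bump s A t ^+ n) ^+ N * bump s A t ^+ j) -
  W t * ((1 - bump s A t ^+ n) ^+ N * bump s A t ^+ (n + j)))).
  by apply: eq_Rintegral => t _; rewrite E.
by rewrite [LHS](RintegralB measurableT i1 i2) e1 e2 subr0.
Qed.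

End laplace_uniqueness.

(** * Polynomials converging boundedly to a step function *)

Section threshold_polynomials.
Variable R : realType.

Lemma cvg_natmul_geometric (z : R) : 0 <= z -> z < 1 ->
  n%:R * z ^+ n @[n --> \oo] --> (0 : R).
Proof.
move=> z0 z1; pose w := Num.sqrt z.
have w0 : 0 <= w by exact: sqrtr_ge0.
have w1 : w < 1 by rewrite -sqrtr1 ltr_sqrt.
have zw : z = w ^+ 2 by rewrite sqr_sqrtr.
(* Each of the [n] terms of [(1 - w) (1 + ... + w^(n-1)) = 1 - w^n] is at least [w^n (1 - w)]. Hence
   [n w^n] is bounded and [n z^n] decays like [w^n]. *)
have key n : n%:R * w ^+ n * (1 - w) + w ^+ n <= 1.
  elim: n => [|n IH]; first by rewrite mul0r mul0r add0r expr0.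
  rewrite -natr1 exprS.
  have wn : w ^+ n <= 1 by rewrite exprn_ile1// ltW.
  have : w * (n%:R * w ^+ n * (1 - w) + w ^+ n) <= w * 1 by rewrite ler_wpM2l.
  have : w ^+ n * (w * (1 - w)) <= 1 * (w * (1 - w)).
    by rewrite ler_wpM2r// mulr_ge0// subr_ge0 ltW.
  have : w * (1 - w) <= 1 * (1 - w) by rewrite ler_wpM2r ?subr_ge0 ?(ltW w1).
  nra.
apply: (@squeeze_cvgr _ _ _ _ (fun=> 0) (geometric (1 - w)^-1 w)).
- apply: nearW => n /=; rewrite mulr_ge0 ?exprn_ge0//= zw -exprM mulnC exprM expr2.
  rewrite mulrA ler_wpM2r ?exprn_ge0// -[leRHS]mul1r ler_pdivlMr ?subr_gt0//.
  have := key n; have := exprn_ge0 n w0; lra.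
- exact: cvg_cst.
- by apply: cvg_geometric; rewrite ger0_norm.
Qed.

Lemma bernoulli_le (x : R) N : 0 <= x -> x <= 1 -> 1 - N%:R * x <= (1 - x) ^+ N.
Proof.
move=> x0 x1; elim: N => [|N IH]; first by rewrite mul0r subr0 expr0.
rewrite exprS -natr1; have : (1 - x) * (1 - N%:R * x) <= (1 - x) * (1 - x) ^+ N.
  by rewrite ler_wpM2l ?subr_ge0.
have : 0 <= N%:R * (x * x) by rewrite !mulr_ge0.
nra.
Qed.

(* The extra factor [n] in the exponent makes the limit [0] also at the
   threshold [u = 1 / M] itself. *)
Lemma cvg_threshold (M : nat) (u : R) : 0 <= u -> u <= 1 ->
  (1 - u ^+ n) ^+ (n * M ^ n) @[n --> \oo] --> ((u * M%:R < 1)%R%:R : R).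
Proof.
move=> u0 u1.
have un n : 0 <= u ^+ n <= 1 by rewrite exprn_ge0//= exprn_ile1.
have eN n : (n * M ^ n)%:R * u ^+ n = n%:R * (u * M%:R) ^+ n.
  by rewrite natrM natrX exprMn; ring.
have [uM|uM] := ltP (u * M%:R) 1; rewrite /=.
- apply: (@squeeze_cvgr _ _ _ _ (fun n => 1 - n%:R * (u * M%:R) ^+ n) (fun=> 1)).
  + apply: nearW => n; have /andP[un0 un1] := un n; apply/andP; split.
      by rewrite -eN; exact: bernoulli_le.
    by rewrite exprn_ile1// ?subr_ge0// gerBl.
  + rewrite -[X in _ --> X]subr0; apply: cvgB; first exact: cvg_cst.
    by apply: cvg_natmul_geometric => //; rewrite mulr_ge0.
  + exact: cvg_cst.
- apply: (@squeeze_cvgr _ _ _ _ (fun=> 0) (geometric 1 (expR (- 1)))).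
  + apply: nearW => n; have /andP[un0 un1] := un n; apply/andP; split.
      by rewrite exprn_ge0// subr_ge0.
    rewrite /= mul1r -expRM_natl.
    apply: (@le_trans _ _ (expR (- u ^+ n) ^+ (n * M ^ n))).
      by rewrite lerXn2r ?nnegrE ?subr_ge0 ?expR_ge0// expR_ge1Dx.
    rewrite -expRM_natl ler_expR mulrN eN mulrN1 lerN2.
    by rewrite ler_peMr// exprn_ege1.
  + exact: cvg_cst.
  + by apply: cvg_geometric; rewrite ger0_norm ?expR_ge0// expR_lt1; lra.
Qed.

End threshold_polynomials.

(** * From vanishing Laplace transforms to Borel sets in one variable *)

Section laplace_uniqueness_borel.
Context (d : measure_display) (T : measurableType d) (R : realType).
Variable m : {measure set T -> \bar R}.
Variable X : T -> R.
Hypothesis mX : measurable_fun setT X.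
Variable c : R.
Hypothesis c0 : 0 < c.
Variable W : T -> R.
Hypothesis hW : laplace_null m X c W.

Let iW : Rintegrable m W.
Proof.
have := laplace_monomial_integrable mX c0 0 0 hW; apply: eq_integrable => // t _.
by rewrite /= expr0 mul0r expR0 !mulr1.
Qed.

Let W0 : \int[m]_t W t = 0.
Proof.
have [_ _ /(_ 0) h] := hW; rewrite -[RHS]h; apply: eq_Rintegral => t _.
by rewrite mul0r expR0 mulr1.
Qed.

Lemma laplace_unique_itv (a b : R) :
  \int[m]_t (W t * \1_(X @^-1` `[a, b]) t) = 0.
Proof.
have mI : measurable (X @^-1` `[a, b]) by rewrite -[X in measurable X]setTI; exact: mX.
have [ab|ba] := leP a b; last first.
  transitivity (\int[m]_t (0 : R)); last by rewrite Rintegral_cst// mul0r.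
  apply: eq_Rintegral => t _; rewrite indicE memNset ?mulr0//= in_itv/=.
  by move=> /andP[aX /(le_trans aX)]; rewrite leNgt ba.
(* The bump is centred at the midpoint and scaled so that it equals [1 / M] exactly at the
   endpoints. [M] is an integer since it enters an exponent, and [M >= E] keeps the bump within
   [[0, 1]]. *)
pose s := (a + b) / 2; pose p := (b - a) / 2.
pose E := expR (c / 2 * p ^+ 2).
pose M := (Num.truncn E).+1.
have E0 : 0 < E := expR_gt0 _.
have EM : E <= M%:R by rewrite ltW// truncnS_gt.
have M0 : 0 < M%:R :> R by rewrite ltr0n.
pose A := E / M%:R.
have A0 : 0 <= A by rewrite divr_ge0 ?ltW.
have A1 : A <= 1 by rewrite ler_pdivrMr// mul1r.
have q0 t : 0 <= bump X c s A t by rewrite mulr_ge0 ?expR_ge0.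
have q1 t : bump X c s A t <= 1.
  rewrite -[leRHS]mul1r ler_pM ?expR_ge0// -expR0 ler_expR mulNr oppr_le0.
  by rewrite mulr_ge0 ?sqr_ge0 ?divr_ge0 ?(ltW c0).
have qM t : (bump X c s A t * M%:R < 1) = ~~ (a <= X t <= b).
  rewrite /bump /A mulrAC divfK ?gt_eqF// /E -expRD expR_lt1.
  rewrite mulNr -mulrN -mulrDr pmulr_rlt0 ?divr_gt0//.
  rewrite subr_lt0 ltNge; congr negb.
  have p0 : 0 <= p by rewrite divr_ge0// subr_ge0.
  rewrite -[(X t - s) ^+ 2]real_normK ?num_real// ler_pXn2r ?nnegrE//.
  by rewrite ler_norml /s /p; apply/andP/andP => -[h1 h2]; split; lra.
(* The bump is below the threshold [1 / M] outside the interval, so the polynomials tend to the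
   indicator of the complement. *)
have comp : \int[m]_t (W t * (1 - \1_(X @^-1` `[a, b]) t)) = 0.
  apply: (@Rintegral_limit0 _ _ _ m (fun n t => W t *
      ((1 - bump X c s A t ^+ n) ^+ (n * M ^ n) * bump X c s A t ^+ 0)) _
      (fun t => `|W t|)).
  - by move=> n; exact: Rintegrable_measurable (bump_polynomial mX c0 _ _ _ _ _ hW).1.
  - apply: measurable_funM; first exact: Rintegrable_measurable iW.
    by apply: measurable_funB.
  - move=> t; apply: cvgM; first exact: cvg_cst.
    rewrite (_ : 1 - _ = (bump X c s A t * M%:R < 1)%R%:R).
      rewrite (_ : (fun n => _) = (fun n => (1 - bump X c s A t ^+ n) ^+ (n * M ^ n))).
        exact: cvg_threshold.
      by apply/funext => n; rewrite expr0 mulr1.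
    rewrite qM indicE.
    have -> : (t \in X @^-1` `[a, b]) = (a <= X t <= b).
      by apply/idP/idP => [/set_mem|h]; [|apply/mem_set]; rewrite /= in_itv.
    by case: (_ <= _ <= _); rewrite ?subrr ?subr0.
  - exact: Rintegrable_norm.
  - move=> n t; rewrite normrM ler_piMr// expr0 mulr1 normrX exprn_ile1//.
    have h1 := exprn_ge0 n (q0 t); have h2 := exprn_ile1 n (q0 t) (q1 t).
    by rewrite ler_norml; apply/andP; split; lra.
  - by move=> n; exact: (bump_polynomial mX c0 _ _ _ _ _ hW).2.
transitivity (\int[m]_t (W t - W t * (1 - \1_(X @^-1` `[a, b]) t))).
  by apply: eq_Rintegral => t _; ring.
rewrite (RintegralB measurableT iW) ?W0 ?comp ?subrr//.
have := RintegrableB iW (Rintegrable_indic iW mI); apply: eq_integrable => // t _.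
by apply: (congr1 EFin); ring.
Qed.

Lemma laplace_unique (B : set R) : measurable B ->
  \int[m]_t (W t * \1_(X @^-1` B) t) = 0.
Proof.
move=> /measurable_closed_itv mB.
pose G : set (set R) := [set B | exists a b, B = `[a, b]%classic].
have := @integral_pi_lambda _ _ _ m W iW (preimage_set_system setT X G).
move=> /(_ _ _ W0) H; apply: (H _ _ _ _).2.
- move=> _ _ [_ [a1 [b1 ->]] <-] [_ [a2 [b2 ->]] <-].
  rewrite !setTI -preimage_setI; exists (`[a1, b1] `&` `[a2, b2]); last by rewrite setTI.
  exists (Num.max a1 a2), (Num.min b1 b2).
  apply/seteqP; split=> y /=; rewrite !in_itv/= ge_max le_min.
    by move=> [/andP[-> ->] /andP[-> ->]].
  by move=> /andP[/andP[-> ->] /andP[-> ->]].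
- move=> _ [_ [a [b ->]] <-]; rewrite setTI; split; last exact: laplace_unique_itv.
  by rewrite -[X in measurable X]setTI; exact: mX.
- rewrite g_sigma_preimageE; exists B => //.
  by rewrite setTI.
Qed.

End laplace_uniqueness_borel.

(** * Gaussians and Laplace transforms on tuples *)

Section gauss_integral_tuple.
Variable R : realType.

Definition shifted_gauss n (y : 'I_n -> R) (t : n.-tuple R) : R :=
  expR (- pi * \sum_i (tnth t i - y i) ^+ 2).

Lemma measurable_shifted_gauss n (y : 'I_n -> R) :
  measurable_fun setT (shifted_gauss y).
Proof.
apply: measurableT_comp => //; apply: measurable_funM => //.
apply: measurable_sum => i; apply: measurable_funX; apply: measurable_funB => //.
exact: measurable_tnth.
Qed.

Lemma integral_gauss1 (y : R) :
  (\int[@lebesgue_measure R]_x (expR (- pi * (x - y) ^+ 2))%:E = 1)%E.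
Proof.
(* The Gaussian is the normal density of variance [1 / (2 pi)], whose normalising factor is 1. *)
pose s : R := Num.sqrt (2 * pi)^-1.
have pi0 := pi_gt0 R.
have s2 : s ^+ 2 = (2 * pi)^-1 by rewrite sqr_sqrtr// invr_ge0 mulr_ge0 ?pi_ge0.
have s0 : s != 0 by rewrite sqrtr_eq0 -ltNge invr_gt0 mulr_gt0.
rewrite -[RHS](integral_normal_pdf y s); apply: eq_integral => x _.
rewrite normal_pdfE// /normal_peak /normal_fun s2.
have [e1 e2] : (2 * pi)^-1 * pi *+ 2 = 1 :> R /\
    - pi * (x - y) ^+ 2 = - (x - y) ^+ 2 / ((2 * pi)^-1 *+ 2) :> R.
  move: (pi : R) pi0 => p p0.
  by rewrite !mulr2n; split; field; rewrite gt_eqF.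
by rewrite e1 sqrtr1 invr1 mul1r e2.
Qed.

Lemma iint_shifted_gauss n (y : 'I_n -> R) :
  iint (fun t => (shifted_gauss y t)%:E) = 1%E.
Proof.
elim: n y => [|n IH] y /=.
  by rewrite /shifted_gauss big_ord0 mulr0 expR0.
rewrite -[RHS](integral_gauss1 (y ord0)); apply: eq_integral => x _.
have [m [mE _]] := exists_iint_measure R n.
have E t : shifted_gauss y (cons_tuple x t) =
    expR (- pi * (x - y ord0) ^+ 2) * shifted_gauss (y \o lift ord0) t.
  rewrite /shifted_gauss big_ord_recl mulrDr expRD; congr (_ * expR (_ * _)).
  by apply: eq_bigr => i _; rewrite tnthS.
pose g : n.-tuple R -> R := @shifted_gauss n (y \o lift ord0).
have mg : measurable_fun setT (fun t => (g t)%:E).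
  apply/measurable_EFinP. exact: (@measurable_shifted_gauss n).
have g0 t : (0 <= (g t)%:E)%E by rewrite lee_fin expR_ge0.
transitivity (iint (fun t => (expR (- pi * (x - y ord0) ^+ 2))%:E * (g t)%:E)%E).
  by apply: (congr1 (@iint R n)); apply/funext => t; rewrite E EFinM.
rewrite mE; last 2 first.
- by apply: emeasurable_funM.
- by move=> t; rewrite mule_ge0 ?lee_fin ?expR_ge0.
by rewrite ge0_integralZl ?lee_fin ?expR_ge0// -mE// IH mule1.
Qed.

End gauss_integral_tuple.

(** * Laplace uniqueness in several variables *)

Section tuple_uniqueness.
Variables (R : realType) (n : nat).
Variable m : {measure set (n.-tuple R) -> \bar R}.
Variable f : n.-tuple R -> R.
Hypothesis mf : measurable_fun setT f.

Definition sqnorm (t : n.-tuple R) : R := \sum_i tnth t i ^+ 2.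
Hypothesis iF : Rintegrable m (fun t => f t * expR (- (pi / 2) * sqnorm t)).

(** Interpolates between exponentials in all coordinates, at [k = 0], and the indicator of a box, at
    [k = n]. *)
Definition laplace_factor (k : nat) (B : 'I_n -> set R) (x : 'I_n -> R)
    (i : 'I_n) (t : n.-tuple R) : R :=
  if (i < k)%N then \1_(B i) (tnth t i) else expR (x i * tnth t i).

Lemma measurable_sqnorm : measurable_fun setT sqnorm.
Proof.
by apply: measurable_sum => i; apply: measurable_funX; exact: measurable_tnth.
Qed.

Lemma measurable_expR_sqnorm (a : R) :
  measurable_fun setT (fun t => expR (a * sqnorm t)).
Proof.
apply: measurableT_comp => //; apply: measurable_funM => //.
exact: measurable_sqnorm.
Qed.

Lemma measurable_laplace_factor k B x i : (forall i, measurable (B i)) ->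
  measurable_fun setT (laplace_factor k B x i).
Proof.
move=> mB; rewrite /laplace_factor; case: (i < k)%N.
  have mI : measurable_fun setT (\1_(B i) : R -> R) by exact: measurable_indic.
  exact: (measurableT_comp mI (measurable_tnth i)).
apply: measurableT_comp => //; apply: measurable_funM => //.
exact: measurable_tnth.
Qed.

Lemma laplace_factor_bound k B x i t :
  `|laplace_factor k B x i t| <= expR (pi / 4 * tnth t i ^+ 2 + x i ^+ 2 / pi).
Proof.
have pi0 := pi_gt0 R.
have e0 : 0 <= pi / 4 * tnth t i ^+ 2 by rewrite mulr_ge0 ?sqr_ge0// divr_ge0// ltW.
have e1 : 0 <= x i ^+ 2 / pi by rewrite divr_ge0 ?sqr_ge0// ltW.
rewrite /laplace_factor; case: ifP => _.
  apply: (@le_trans _ _ 1); first by rewrite indicE; case: (_ \in _); rewrite ?normr1 ?normr0.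
  by rewrite -[leLHS]expR0 ler_expR addr_ge0.
rewrite (ger0_norm (expR_ge0 _)) ler_expR -subr_ge0.
move: (pi : R) pi0 => p p0.
have -> : p / 4 * tnth t i ^+ 2 + x i ^+ 2 / p - x i * tnth t i =
  (p / 2 * tnth t i - x i) ^+ 2 / p by field; rewrite gt_eqF.
by rewrite divr_ge0 ?sqr_ge0 ?(ltW p0).
Qed.

Lemma laplace_factor_prod_bound k B x (P : pred 'I_n) t :
  `|\prod_(i | P i) laplace_factor k B x i t| <=
  expR (pi / 4 * sqnorm t + (\sum_i x i ^+ 2) / pi).
Proof.
have pi0 := pi_gt0 R.
have -> : pi / 4 * sqnorm t + (\sum_i x i ^+ 2) / pi =
    \sum_i (pi / 4 * tnth t i ^+ 2 + x i ^+ 2 / pi).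
  by rewrite /sqnorm mulr_sumr mulr_suml -big_split.
rewrite expR_sum normr_prod big_mkcond/=; apply: ler_prod => i _.
have := laplace_factor_bound k B x i t => h; case: ifP => _; first by rewrite normr_ge0.
rewrite ler01/= -[leLHS]expR0 ler_expR addr_ge0//.
  by rewrite mulr_ge0 ?sqr_ge0 ?divr_ge0 ?(ltW pi0).
by rewrite divr_ge0 ?sqr_ge0 ?(ltW pi0).
Qed.

Lemma laplace_null_factor k B x (j : 'I_n) : (forall i, measurable (B i)) ->
  (forall x', \int[m]_t (f t * expR (- pi * sqnorm t) *
    \prod_(i | i != j) laplace_factor k B x i t * expR (x' * tnth t j)) = 0) ->
  laplace_null m (fun t => tnth t j) (pi / 4)
    (fun t => f t * expR (- pi * sqnorm t) *
      \prod_(i | i != j) laplace_factor k B x i t).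
Proof.
move=> mB h0; have pi0 := pi_gt0 R.
have mW : measurable_fun setT (fun t => f t * expR (- pi * sqnorm t) *
      \prod_(i | i != j) laplace_factor k B x i t).
  apply: measurable_funM.
    by apply: measurable_funM => //; exact: measurable_expR_sqnorm.
  under eq_fun do rewrite big_mkcond/=.
  by apply: measurable_prod => i _; case: (i != j) => //; exact: measurable_laplace_factor.
split=> //.
apply: le_Rintegrable (RintegrableZ (expR ((\sum_i x i ^+ 2) / pi)) (Rintegrable_norm iF)) => [|t].
  apply: measurable_funM => //; apply: measurableT_comp => //.
  by apply: measurable_funM => //; apply: measurable_funX; exact: measurable_tnth.
rewrite !normrM !(ger0_norm (expR_ge0 _)) -!mulrA [leRHS]mulrCA ler_wpM2l//.
apply: (@le_trans _ _ (expR (- pi * sqnorm t) * (expR (pi / 4 * sqnorm t + (\sum_i x i ^+ 2) / pi) *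
   expR (pi / 4 * sqnorm t)))).
  rewrite ler_wpM2l ?expR_ge0// ler_pM ?expR_ge0 ?laplace_factor_prod_bound//.
  rewrite ler_expR mulrA ler_wpM2l ?divr_ge0 ?(ltW pi0)// /sqnorm (bigD1 j)//= lerDl.
  by rewrite sumr_ge0// => i _; exact: sqr_ge0.
rewrite -!expRD ler_expR; lra.
Qed.

(** Since [x] is free, the statement for [k] is a vanishing Laplace transform in coordinate [k] with
    the other factors frozen; one-variable uniqueness replaces that exponential by an indicator. *)
Lemma laplace_box k B x : (k <= n)%N -> (forall i, measurable (B i)) ->
  (forall x, \int[m]_t (f t * expR (- pi * sqnorm t) *
     \prod_i expR (x i * tnth t i)) = 0) ->
  \int[m]_t (f t * expR (- pi * sqnorm t) * \prod_i laplace_factor k B x i t) = 0.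
Proof.
move=> + mB h0; elim: k x => [|k IH] x kn; first exact: h0.
pose j := Ordinal kn.
have := @laplace_null_factor k B x j mB.
have pre x' : \int[m]_t (f t * expR (- pi * sqnorm t) *
    \prod_(i | i != j) laplace_factor k B x i t * expR (x' * tnth t j)) = 0.
  rewrite -[RHS](IH (fun i => if i == j then x' else x i) (ltnW kn)).
  apply: eq_Rintegral => t _; rewrite -mulrA; congr (_ * _).
  rewrite [RHS](bigD1 j)//= mulrC; congr (_ * _).
    by rewrite /laplace_factor /= ltnn eqxx.
  by apply: eq_bigr => i ij; rewrite /laplace_factor (negbTE ij).
move=> /(_ pre) hW.
have c0 : 0 < pi / 4 :> R by rewrite divr_gt0 ?pi_gt0.
rewrite -[RHS](laplace_unique (measurable_tnth j) c0 hW (mB j)).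
apply: eq_Rintegral => t _; rewrite -[RHS]mulrA; congr (_ * _).
rewrite (bigD1 j)//= mulrC; congr (_ * _); last first.
  by rewrite /laplace_factor /= ltnSn.
apply: eq_bigr => i ij; rewrite /laplace_factor ltnS leq_eqVlt.
by rewrite (_ : (i == k :> nat) = false)//; apply/negbTE.
Qed.

Lemma tuple_laplace_unique :
  (forall x : 'I_n -> R, \int[m]_t (f t * expR (- pi * sqnorm t) *
     \prod_i expR (x i * tnth t i)) = 0) ->
  {ae m, forall t, f t = 0}.
Proof.
move=> h0; have pi0 := pi_gt0 R.
pose F t := f t * expR (- pi * sqnorm t).
have iF' : Rintegrable m F.
  apply: le_Rintegrable (Rintegrable_norm iF) => [|t].
    by apply: measurable_funM => //; exact: measurable_expR_sqnorm.
  rewrite !normrM ler_wpM2l// !(ger0_norm (expR_ge0 _)) ler_expR ler_wpM2r//.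
    by rewrite sumr_ge0// => i _; exact: sqr_ge0.
  by rewrite lerN2; lra.
(* Boxes with measurable sides are closed under intersection and contain the generating cylinders,
   whose other sides are the whole line. *)
pose box (B : 'I_n -> set R) := [set t : n.-tuple R | forall i, B i (tnth t i)].
pose G := [set A | exists2 B : 'I_n -> set R, (forall i, measurable (B i)) & A = box B].
have GI : setI_closed G.
  move=> _ _ [B1 mB1 ->] [B2 mB2 ->].
  exists (fun i => B1 i `&` B2 i); first by move=> i; exact: measurableI.
  by apply/seteqP; split=> [t [t1 t2] i|t tt]; [split|split=> i; have [] := tt i].
have sG : measurable `<=` <<s G >>.
  apply: smallest_sub; first exact: smallest_sigma_algebra.
  move=> A; rewrite -bigcup_seq => -[i _ [C mC <-]]; apply: sub_sigma_algebra.
  exists (fun k => if k == i then C else setT) => [k|]; first by case: ifP.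
  apply/seteqP; split=> t /=.
    by move=> [_ Ct] k; case: eqP => [->|].
  by move=> /(_ i); rewrite eqxx.
have mbox B : (forall i, measurable (B i)) -> measurable (box B).
  move=> mB; rewrite (_ : box B = \bigcap_(i in [set: 'I_n])
      ((fun t : n.-tuple R => tnth t i) @^-1` B i)).
    apply: fin_bigcap_measurable => // i _.
    by rewrite -[X in measurable X]setTI; exact: measurable_tnth.
  by apply/seteqP; split=> t tt i; [move=> _|]; exact: tt.
have G0 A : G A -> measurable A /\ \int[m]_t (F t * \1_A t) = 0.
  move=> [B mB ->]; split; first exact: mbox.
  rewrite -[RHS](@laplace_box n B (fun=> 0) (leqnn n) mB h0).
  apply: eq_Rintegral => t _; congr (_ * _).
  rewrite indicE; have [/set_mem tB|tB] := boolP (t \in box B).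
    by rewrite big1// => i _; rewrite /laplace_factor ltn_ord indicE mem_set//; exact: tB.
  move: tB; rewrite notin_setE => /existsNP[i nB].
  by rewrite (bigD1 i)//= /laplace_factor ltn_ord indicE memNset// mul0r.
have F0 : \int[m]_t F t = 0.
  rewrite -[RHS](h0 (fun=> 0)); apply: eq_Rintegral => t _.
  by rewrite big1 ?mulr1// => i _; rewrite mul0r expR0.
have : {ae m, forall t, F t = 0}.
  apply: integral_eq0_ae => // A /sG sA.
  exact: (integral_pi_lambda iF' GI G0 F0 sA).2.
apply: filterS => t /eqP; rewrite mulf_eq0 (gt_eqF (expR_gt0 _)) orbF.
by move=> /eqP.
Qed.

End tuple_uniqueness.

(** * The short-time Fourier transform *)

Lemma Rintegral_cvg0 (d : measure_display) (T : measurableType d) (R : realType)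
    (m : {measure set T -> \bar R}) (f_ : nat -> T -> R) (g : T -> R) :
  (forall n, measurable_fun setT (f_ n)) ->
  (forall t, f_ n t @[n --> \oo] --> (0 : R)) ->
  Rintegrable m g -> (forall n t, `|f_ n t| <= g t) ->
  forall e : R, 0 < e -> exists n, \int[m]_t f_ n t <= e.
Proof.
move=> mf_ f_0 ig f_g e e0.
have [] := @dominated_convergence _ _ _ m setT measurableT
  (fun n => EFin \o f_ n) (cst 0%E) (EFin \o g).
- by move=> n; exact/measurable_EFinP.
- exact: measurable_cst.
- by apply: aeW => t _; apply/cvg_EFin; [exact: nearW|exact: f_0].
- exact: ig.
- by apply: aeW => t n _ /=; rewrite lee_fin.
move=> _ _; rewrite integral0 => cv.
have : (\int[m]_t f_ n t @[n --> \oo] --> (0 : R)).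
  by apply: fine_cvg; exact: cv.
move=> /cvgrPdist_le/(_ e e0)[k _ /(_ k (leqnn k))].
by rewrite /= sub0r normrN => /(le_trans (ler_norm _)); exists k.
Qed.

(** A geometric rate that depends on [s] only through its absolute value; from
    [pi * w ^+ 2 >= w - 1] with [w] the distance from [a] to [s]. *)
Lemma gauss_shift_decay (R : realType) (a s : R) (k : nat) : `|s| = k.+1%:R ->
  expR (- pi * (a - s) ^+ 2) <= expR `|a| * expR (- 1) ^+ k.
Proof.
move=> sk; rewrite -expRM_natl -expRD ler_expR.
have h1 : `|s| <= `|a - s| + `|a| by rewrite (distrC a) -{1}(subrK a s) ler_normD.
rewrite sk -natr1 in h1.
rewrite -[(a - s) ^+ 2]real_normK ?num_real//.
set w := `|a - s| in h1 *.
have p1 : 2 * w ^+ 2 <= pi * w ^+ 2 by rewrite ler_wpM2r ?sqr_ge0 ?pi_ge2.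
have := sqr_ge0 w; have := sqr_ge0 (w - 1); rewrite sqrrB expr1n mulr1; lra.
Qed.

(** * The transform of an L2 function along the first axis *)

Section gabor.
Variables (R : realType) (n : nat).
Notation T := (n.+1.-tuple R).
Variable m : {measure set T -> \bar R}.
Hypothesis gauss_int : forall y : 'I_n.+1 -> R,
  Rintegrable m (shifted_gauss y) /\ \int[m]_t shifted_gauss y t = 1.
Variables fr fi : T -> R.
Hypotheses (mfr : measurable_fun setT fr) (mfi : measurable_fun setT fi).
Hypothesis i2 : Rintegrable m (fun t => fr t ^+ 2 + fi t ^+ 2).

Definition sqdist (y : 'I_n.+1 -> R) (t : T) : R := \sum_i (tnth t i - y i) ^+ 2.

(** From [|f| e <= f^2 + e^2] with [e] the square root of the unit-mass Gaussian: half of the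
    Gaussian decay already suffices for integrability. *)
Lemma L2_gauss_integrable (f h : T -> R) (y : 'I_n.+1 -> R) (K : R) :
  measurable_fun setT f -> (forall t, f t ^+ 2 <= fr t ^+ 2 + fi t ^+ 2) ->
  measurable_fun setT h -> 0 <= K ->
  (forall t, `|h t| <= K * expR (- (pi / 2) * sqdist y t)) ->
  Rintegrable m (fun t => f t * h t).
Proof.
move=> mf f2 mh K0 hK.
apply: le_Rintegrable (RintegrableZ K (RintegrableD i2 (gauss_int y).1)) => [|t].
  exact: measurable_funM.
rewrite normrM; apply: le_trans (ler_wpM2l (normr_ge0 _) (hK t)) _.
rewrite mulrCA ler_wpM2l//.
set e := expR _.
have -> : shifted_gauss y t = e ^+ 2.
  by rewrite -expRM_natl /shifted_gauss -/(sqdist y t); congr expR; field.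
have := f2 t; rewrite -[f t ^+ 2]real_normK ?num_real//.
have := sqr_ge0 (`|f t| - e); have := sqr_ge0 (`|f t| + e); rewrite sqrrB sqrrD.
have := sqr_ge0 `|f t|; have := sqr_ge0 e; lra.
Qed.

Lemma fr_le t : fr t ^+ 2 <= fr t ^+ 2 + fi t ^+ 2.
Proof. by rewrite lerDl sqr_ge0. Qed.

Lemma fi_le t : fi t ^+ 2 <= fr t ^+ 2 + fi t ^+ 2.
Proof. by rewrite lerDr sqr_ge0. Qed.

(** Only the Gaussian in the first coordinate becomes complex; the rest is merged with [f] into the
    integrands [A] and [B] of the strip transform. *)
Definition tail_gauss (y : 'I_n.+1 -> R) (t : T) : R :=
  expR (- pi * \sum_(i < n) (tnth t (lift ord0 i) - y (lift ord0 i)) ^+ 2).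
Definition head_dist (y : 'I_n.+1 -> R) (t : T) : R := tnth t ord0 - y ord0.
Definition shift_head (y : 'I_n.+1 -> R) (s : R) (i : 'I_n.+1) : R :=
  if i == ord0 then y i + s else y i.

Lemma measurable_head_dist y : measurable_fun setT (head_dist y).
Proof. by apply: measurable_funB => //; exact: measurable_tnth. Qed.

Lemma measurable_tail_gauss y : measurable_fun setT (tail_gauss y).
Proof.
apply: measurableT_comp => //; apply: measurable_funM => //.
apply: measurable_sum => i; apply: measurable_funX; apply: measurable_funB => //.
exact: measurable_tnth.
Qed.

Lemma tail_gauss_shift y s t :
  tail_gauss y t * expR (- pi * (head_dist y t - s) ^+ 2) =
  shifted_gauss (shift_head y s) t.
Proof.
rewrite -expRD -mulrDr; congr (expR (_ * _)); rewrite [RHS]big_ord_recl [LHS]addrC.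
congr (_ + _).
by rewrite /head_dist /shift_head eqxx opprD addrA.
Qed.

Lemma weight_integrable_tail (f : T -> R) y : measurable_fun setT f ->
  (forall t, f t ^+ 2 <= fr t ^+ 2 + fi t ^+ 2) ->
  weight_integrable m (head_dist y) (fun t => f t * tail_gauss y t).
Proof.
move=> mf f2; have mtg := measurable_tail_gauss y.
split=> [|c]; first exact: measurable_funM.
have : Rintegrable m (fun t => f t * (tail_gauss y t * gauss_weight c (head_dist y t))).
  (* The constant comes from [c |h| <= pi / 2 * h^2 + c^2 / (2 pi)], which charges the exponential
     to the spare half of the Gaussian. *)
  apply: (@L2_gauss_integrable _ _ y (expR (c ^+ 2 / (2 * pi)))) => //.
    have mh := measurable_head_dist y.
    apply: measurable_funM => //; rewrite /gauss_weight; apply: measurableT_comp => //.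
    apply: measurable_funD; apply: measurable_funM => //; first exact: measurable_funX.
    exact: measurableT_comp.
  move=> t; rewrite ger0_norm ?mulr_ge0 ?expR_ge0//.
  rewrite /tail_gauss /gauss_weight -!expRD ler_expR /sqdist big_ord_recl.
  rewrite -/(head_dist y t); set h := head_dist y t.
  set s := \sum_(i < n) _.
  have s0 : 0 <= s by rewrite sumr_ge0// => i _; exact: sqr_ge0.
  move: (pi : R) (pi_gt0 R) => p p0.
  have h2 : 0 <= (p * `|h| - c) ^+ 2 / (2 * p) by rewrite divr_ge0 ?sqr_ge0 ?mulr_ge0 ?(ltW p0).
  have e : (p * `|h| - c) ^+ 2 / (2 * p) = p / 2 * `|h| ^+ 2 - c * `|h| + c ^+ 2 / (2 * p).
    by field; rewrite gt_eqF.
  rewrite e real_normK ?num_real// in h2.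
  have : 0 <= p * s by rewrite mulr_ge0 ?(ltW p0).
  lra.
by apply: eq_integrable => // t _; apply: (congr1 EFin); rewrite mulrA.
Qed.

Definition stft_re_int (y : 'I_n.+1 -> R) (w : R) (t : T) : R :=
  (fr t * cos (2 * pi * (tnth t ord0 * w)) + fi t * sin (2 * pi * (tnth t ord0 * w)))
  * shifted_gauss y t.
Definition stft_im_int (y : 'I_n.+1 -> R) (w : R) (t : T) : R :=
  (fi t * cos (2 * pi * (tnth t ord0 * w)) - fr t * sin (2 * pi * (tnth t ord0 * w)))
  * shifted_gauss y t.

Lemma measurable_phase (w : R) :
  measurable_fun setT (fun t : T => cos (2 * pi * (tnth t ord0 * w))) /\
  measurable_fun setT (fun t : T => sin (2 * pi * (tnth t ord0 * w))).
Proof.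
have mt : measurable_fun setT (fun t : T => 2 * pi * (tnth t ord0 * w)).
  by apply: measurable_funM => //; apply: measurable_funM => //; exact: measurable_tnth.
split.
- exact: (measurableT_comp (continuous_measurable_fun (@continuous_cos R)) mt).
- exact: (measurableT_comp (continuous_measurable_fun (@continuous_sin R)) mt).
Qed.

Lemma phase_gauss_integrable (f phase : T -> R) y : measurable_fun setT f ->
  (forall t, f t ^+ 2 <= fr t ^+ 2 + fi t ^+ 2) ->
  measurable_fun setT phase -> (forall t, `|phase t| <= 1) ->
  Rintegrable m (fun t => f t * (phase t * shifted_gauss y t)).
Proof.
move=> mf f2 mp p1; apply: (@L2_gauss_integrable _ _ y 1) => //.
  by apply: measurable_funM => //; exact: measurable_shifted_gauss.
move=> t; rewrite mul1r normrM (ger0_norm (expR_ge0 _)).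
apply: (@le_trans _ _ (shifted_gauss y t)); first by rewrite ler_piMl ?expR_ge0.
rewrite /shifted_gauss -/(sqdist y t) ler_expR.
rewrite ler_wpM2r ?sumr_ge0// => [i _|]; first exact: sqr_ge0.
have := pi_gt0 R; lra.
Qed.

Lemma stft_int_integrable y w :
  Rintegrable m (stft_re_int y w) /\ Rintegrable m (stft_im_int y w).
Proof.
have [mc ms] := measurable_phase w.
have ic (f : T -> R) (mf : measurable_fun setT f)
    (f2 : forall t, f t ^+ 2 <= fr t ^+ 2 + fi t ^+ 2) :=
  phase_gauss_integrable y mf f2 mc (fun t => cos_max _).
have is_ (f : T -> R) (mf : measurable_fun setT f)
    (f2 : forall t, f t ^+ 2 <= fr t ^+ 2 + fi t ^+ 2) :=
  phase_gauss_integrable y mf f2 ms (fun t => sin_max _).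
split.
- have := RintegrableD (ic _ mfr fr_le) (is_ _ mfi fi_le).
  by apply: eq_integrable => // t _; apply: (congr1 EFin); rewrite /stft_re_int; ring.
- have := RintegrableB (ic _ mfi fi_le) (is_ _ mfr fr_le).
  by apply: eq_integrable => // t _; apply: (congr1 EFin); rewrite /stft_im_int; ring.
Qed.

Definition stft_mod y w : R :=
  cabs (\int[m]_t stft_re_int y w t) (\int[m]_t stft_im_int y w t).

Let A y t := fr t * tail_gauss y t.
Let B y t := fi t * tail_gauss y t.

(** The kernel oscillates relative to the centre [y ord0 + x], the transform relative to the origin;
    they differ by the constant phase [phi], which [cabs_rotate] removes. *)
Lemma strip_absE y x w : strip_abs m (head_dist y) (A y) (B y) x w =
  expR (pi * w ^+ 2) * stft_mod (shift_head y x) w.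
Proof.
pose phi := 2 * pi * ((y ord0 + x) * w).
pose P := stft_re_int (shift_head y x) w; pose Q := stft_im_int (shift_head y x) w.
have [iP iQ] := stft_int_integrable (shift_head y x) w.
pose e := expR (pi * w ^+ 2).
have kernel t : tail_gauss y t * strip_cos (head_dist y t - x) w =
    e * (shifted_gauss (shift_head y x) t * cos (2 * pi * (tnth t ord0 * w) - phi)) /\
  tail_gauss y t * strip_sin (head_dist y t - x) w =
    e * (shifted_gauss (shift_head y x) t * sin (2 * pi * (tnth t ord0 * w) - phi)).
  rewrite -tail_gauss_shift /strip_cos /strip_sin.
  have -> : 2 * pi * ((head_dist y t - x) * w) = 2 * pi * (tnth t ord0 * w) - phi.
    by rewrite /head_dist /phi; ring.
  have -> : pi * (w ^+ 2 - (head_dist y t - x) ^+ 2) =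
    pi * w ^+ 2 + - pi * (head_dist y t - x) ^+ 2 by ring.
  by rewrite expRD -/e; split; ring.
have lin (a b : R) : \int[m]_t (a * P t + b * Q t) = a * \int[m]_t P t + b * \int[m]_t Q t.
  by rewrite RintegralD ?RintegralZl//; exact: RintegrableZ.
have re : strip_transform m (head_dist y) (A y) (B y) x w =
    e * ((\int[m]_t P t) * cos (- phi) + (\int[m]_t Q t) * sin (- phi)).
  rewrite mulrDr !(mulrC (Rintegral _ _ _)) !mulrA -lin; apply: eq_Rintegral => t _.
  have [kc ks] := kernel t.
  rewrite /strip_int /A /B -!mulrA kc ks cosN sinN /P /Q /stft_re_int /stft_im_int.
  by rewrite cosB sinB; ring.
have im : strip_transform m (head_dist y) (B y) (fun t => - A y t) x w =
    e * ((\int[m]_t Q t) * cos (- phi) - (\int[m]_t P t) * sin (- phi)).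
  rewrite addrC -mulNr mulrDr mulNr -mulrN !(mulrC (Rintegral _ _ _)) !mulrA -lin.
  apply: eq_Rintegral => t _; have [kc ks] := kernel t.
  rewrite /strip_int /A /B mulNr -!mulrA kc ks cosN sinN /P /Q /stft_re_int /stft_im_int.
  by rewrite cosB sinB; ring.
by rewrite /strip_abs re im cabsZ ?expR_ge0// cabs_rotate.
Qed.

Lemma gabor_decay y (e : R) : 0 < e -> exists k : nat, forall s : R, `|s| = k.+1%:R ->
  \int[m]_t ((`|A y t| + `|B y t|) * expR (- pi * (head_dist y t - s) ^+ 2)) <= e.
Proof.
move=> e0; pose q t := fr t ^+ 2 + fi t ^+ 2.
have q0 t : 0 <= q t by rewrite addr_ge0 ?sqr_ge0.
(* This majorant of [q] times the moving Gaussian depends on [k] but not on [s], so one choice of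
   [k] serves both signs of [s]. *)
pose h k t := q t * Num.min 1 (expR `|head_dist y t| * expR (- 1) ^+ k).
have min0 k t : 0 <= Num.min 1 (expR `|head_dist y t| * expR (- 1) ^+ k).
  by rewrite le_min ler01/= mulr_ge0 ?exprn_ge0 ?expR_ge0.
have mh k : measurable_fun setT (h k).
  apply: measurable_funM; first exact: Rintegrable_measurable i2.
  apply: measurable_minr => //; apply: measurable_funM => //.
  apply: measurableT_comp => //; apply: measurableT_comp => //.
  exact: measurable_head_dist.
have hq k t : `|h k t| <= q t.
  by rewrite normrM (ger0_norm (q0 t)) ger0_norm// ler_piMr// ge_min lexx.
have [||k hk] := @Rintegral_cvg0 _ _ _ m h q mh _ i2 hq (e / 2 * (e / 2)).
- move=> t; apply: (@squeeze_cvgr _ _ _ _ (fun=> 0)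
    (geometric (q t * expR `|head_dist y t|) (expR (- 1)))).
  + apply: nearW => k; rewrite mulr_ge0//= /h -mulrA ler_wpM2l//.
    by rewrite ge_min lexx orbT.
  + exact: cvg_cst.
  + by apply: cvg_geometric; rewrite ger0_norm ?expR_ge0// expR_lt1; lra.
- by rewrite mulr_gt0 ?divr_gt0.
have ih : Rintegrable m (h k) by apply: le_Rintegrable i2.
exists k => s sk.
have iA := weight_integrable_tail y mfr fr_le.
have iB := weight_integrable_tail y mfi fi_le.
have d0 : 0 < e / 2 by rewrite divr_gt0.
have [ig g1] := gauss_int (shift_head y s).
apply: (@le_trans _ _ (\int[m]_t ((e / 2)^-1 * h k t + e / 2 * shifted_gauss (shift_head y s) t))).
  apply: le_Rintegral => //.
  - exact: (gauss_shift_integrable (measurable_head_dist y) iA iB).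
  - by apply: RintegrableD; exact: RintegrableZ.
  move=> t _; rewrite /A /B !normrM (ger0_norm (expR_ge0 _)) -mulrDl -mulrA.
  rewrite tail_gauss_shift.
  have eh : shifted_gauss (shift_head y s) t <= Num.min 1 (expR `|head_dist y t| * expR (- 1) ^+ k).
    rewrite -tail_gauss_shift le_min; apply/andP; split.
      rewrite -expRD -[leRHS]expR0 ler_expR !mulNr -opprD oppr_le0.
      rewrite addr_ge0// mulr_ge0 ?pi_ge0 ?sqr_ge0// sumr_ge0// => i _.
      exact: sqr_ge0.
    rewrite -[leRHS]mul1r; apply: ler_pM;
      [exact: expR_ge0|exact: expR_ge0| |exact: gauss_shift_decay].
    rewrite -[leRHS]expR0 ler_expR mulNr oppr_le0 mulr_ge0 ?pi_ge0// sumr_ge0// => i _.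
    exact: sqr_ge0.
  (* The constant term meets a Gaussian of mass one and costs [e / 2]; the other costs [e / 2] as
     well, since the integral of [h k] was made at most [(e / 2)^2]. *)
  have amgm : `|fr t| + `|fi t| <= (e / 2)^-1 * q t + e / 2.
    move: (e / 2) d0 => p p0; rewrite -subr_ge0.
    have -> : p^-1 * q t + p - (`|fr t| + `|fi t|) =
      ((`|fr t| - p / 2) ^+ 2 + (`|fi t| - p / 2) ^+ 2) / p + p / 2.
      rewrite /q -[fr t ^+ 2]real_normK ?num_real// -[fi t ^+ 2]real_normK ?num_real//.
      by field; rewrite gt_eqF.
    by rewrite addr_ge0 ?divr_ge0 ?addr_ge0 ?sqr_ge0 ?(ltW p0).
  apply: le_trans (ler_wpM2r (expR_ge0 _) amgm) _.
  rewrite mulrDl lerD2r /h -mulrA ler_wpM2l ?invr_ge0 ?(ltW d0)//.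
  by rewrite ler_wpM2l.
rewrite RintegralD//; [|exact: RintegrableZ..].
rewrite !RintegralZl// g1 mulr1.
have : (e / 2)^-1 * \int[m]_t h k t <= (e / 2)^-1 * (e / 2 * (e / 2)).
  by rewrite ler_wpM2l ?invr_ge0 ?(ltW d0).
rewrite mulKf ?gt_eqF//; lra.
Qed.

Lemma gabor_strip (S M m0 : R) : 0 < S ->
  (forall y w, `|w| = S -> stft_mod y w <= M) ->
  0 < m0 -> expR (pi * S ^+ 2) * M <= m0 ->
  forall y, stft_mod y 0 < m0.
Proof.
move=> S0 hM m00 Mm y.
have := @strip_center_lt _ _ _ m (head_dist y) (measurable_head_dist y) (A y) (B y)
  (weight_integrable_tail y mfr fr_le) (weight_integrable_tail y mfi fi_le)
  S (expR (pi * S ^+ 2) * M) m0 S0 _ _ (@gabor_decay y) m00 Mm.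
rewrite strip_absE expr0n/= mulr0 expR0 mul1r.
have -> : shift_head y 0 = y.
  by apply/funext => i; rewrite /shift_head addr0 if_same.
apply=> x; rewrite strip_absE ?sqrrN ler_wpM2l ?expR_ge0// hM//.
- by rewrite gtr0_norm.
- by rewrite normrN gtr0_norm.
Qed.

Lemma gabor_injective : (forall y, stft_mod y 0 = 0) ->
  {ae m, forall t, fr t ^+ 2 + fi t ^+ 2 = 0}.
Proof.
move=> h0; have pi0 := pi_gt0 R.
have z y : \int[m]_t (fr t * shifted_gauss y t) = 0 /\
    \int[m]_t (fi t * shifted_gauss y t) = 0.
  have := sqr_cabs (\int[m]_t stft_re_int y 0 t) (\int[m]_t stft_im_int y 0 t).
  rewrite -/(stft_mod y 0) h0 expr0n/= => /esym/eqP.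
  rewrite paddr_eq0 ?sqr_ge0// !sqrf_eq0 => /andP[/eqP re /eqP im].
  split; [rewrite -[RHS]re|rewrite -[RHS]im]; apply: eq_Rintegral => t _;
    by rewrite /stft_re_int /stft_im_int !mulr0 cos0 sin0 mulr0 mulr1 ?addr0 ?subr0.
have key (f : T -> R) : measurable_fun setT f ->
    (forall t, f t ^+ 2 <= fr t ^+ 2 + fi t ^+ 2) ->
    (forall y, \int[m]_t (f t * shifted_gauss y t) = 0) ->
    {ae m, forall t, f t = 0}.
  move=> mf f2 f0; apply: tuple_laplace_unique => //.
    apply: (@L2_gauss_integrable f _ (fun=> 0) 1) => //.
      exact: measurable_expR_sqnorm.
    move=> t; rewrite mul1r ger0_norm ?expR_ge0// /sqdist /sqnorm.
    by under [in leRHS]eq_bigr do rewrite subr0.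
  (* A Gaussian centred at [x / (2 pi)] is the centred one times the exponential with rates [x], up
     to the constant that [K] cancels. *)
  move=> x; pose y i := x i / (2 * pi).
  pose K := expR (pi * \sum_i y i ^+ 2).
  have iy : Rintegrable m (fun t => f t * shifted_gauss y t).
    have one (t : T) : `|cst (1 : R) t| <= 1 by rewrite normr1.
    have := phase_gauss_integrable y mf f2 (measurable_cst (1 : R)) one.
    by apply: eq_integrable => // t _; rewrite /= mul1r.
  transitivity (\int[m]_t (K * (f t * shifted_gauss y t))); last first.
    by rewrite RintegralZl// f0 mulr0.
  apply: eq_Rintegral => t _; rewrite -mulrA [RHS]mulrCA; congr (_ * _).
  rewrite -expR_sum -!expRD; congr expR.
  rewrite /sqnorm !mulr_sumr -!big_split/=; apply: eq_bigr => i _.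
  have xE : x i = 2 * pi * y i by rewrite /y mulrC divfK// gt_eqF// mulr_gt0.
  by rewrite xE; ring.
have a1 := key fr mfr fr_le (fun y => (z y).1).
have a2 := key fi mfi fi_le (fun y => (z y).2).
apply: filterS2 a1 a2 => t -> ->.
by rewrite expr0n/= addr0.
Qed.

End gabor.

(** * Frequencies on the first coordinate axis *)

Section first_axis.
Variables (R : realType) (n : nat).

Definition axis (w : R) : n.+1.-tuple R :=
  [tuple if i == ord0 then w else 0 | i < n.+1].

Lemma dotp_axis (t : n.+1.-tuple R) w : dotp t (axis w) = tnth t ord0 * w.
Proof.
rewrite /dotp (bigD1 ord0)//= tnth_mktuple eqxx big1 ?addr0// => i i0.
by rewrite tnth_mktuple (negbTE i0) mulr0.
Qed.

Lemma enorm_axis w : enorm (axis w) = `|w|.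
Proof. by rewrite /enorm dotp_axis tnth_mktuple eqxx -expr2 sqrtr_sqr. Qed.

Lemma gauss_subvE (t x : n.+1.-tuple R) :
  gauss (subv t x) = shifted_gauss (tnth x) t.
Proof.
rewrite /gauss /dotp /shifted_gauss; congr (expR (_ * _)).
by apply: eq_bigr => i _; rewrite tnth_mktuple expr2.
Qed.

Lemma gaussE (t : n.+1.-tuple R) : gauss t = shifted_gauss (fun=> 0) t.
Proof.
rewrite /gauss /dotp /shifted_gauss; congr (expR (_ * _)).
by apply: eq_bigr => i _; rewrite subr0 expr2.
Qed.

End first_axis.

Theorem theorem1 (R : realType) (d : nat) (Rad N : R)
    (fr fi : d.-tuple R -> R) :
  (1 <= d)%N -> 0 < Rad -> 1 < N ->
  L2 fr fi -> L2_nonzero fr fi ->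
  (forall x w : d.-tuple R, enorm w = Rad ->
     stft_abs fr fi x w <= inner_abs fr fi / N) ->
  Num.sqrt (ln N / pi) < Rad.
Proof.
case: d fr fi => [//|n] fr fi _ Rad0 N1 [mfr mfi f2] nz hV.
have [m [mE0 mE]] := exists_iint_measure R n.+1.
have gint (y : 'I_n.+1 -> R) : Rintegrable m (shifted_gauss y) /\
    \int[m]_t shifted_gauss y t = 1.
  have mg : measurable_fun setT (fun t => (shifted_gauss y t)%:E).
    by apply/measurable_EFinP; exact: (@measurable_shifted_gauss R n.+1).
  have g1 : (\int[m]_t (shifted_gauss y t)%:E = 1)%E.
    rewrite -mE0 ?iint_shifted_gauss// => t.
    by rewrite lee_fin expR_ge0.
  split; last by rewrite /Rintegral g1.
  apply/integrableP; split=> //.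
  under eq_integral do rewrite /= ger0_norm ?expR_ge0//.
  by rewrite g1 ltry.
have mq : measurable_fun setT (fun t => (fr t ^+ 2 + fi t ^+ 2)%:E).
  by apply/measurable_EFinP; apply: measurable_funD; exact: measurable_funX.
have q0 t : (0 <= (fr t ^+ 2 + fi t ^+ 2)%:E)%E.
  by rewrite lee_fin addr_ge0 ?sqr_ge0.
have i2 : Rintegrable m (fun t => fr t ^+ 2 + fi t ^+ 2).
  apply/integrableP; split=> //.
  under eq_integral do rewrite /= ger0_norm ?addr_ge0 ?sqr_ge0//.
  by rewrite -mE0.
have stftE x w : stft_abs fr fi x (axis n w) = stft_mod m fr fi (tnth x) w.
  have [iP iQ] := stft_int_integrable gint mfr mfi i2 (tnth x) w.
  have re : stft_re fr fi x (axis n w) = \int[m]_t stft_re_int fr fi (tnth x) w t.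
    rewrite /Rintegral -(mE _ iP) /stft_re; apply: (congr1 fine).
    apply: (congr1 (@iint R n.+1)); apply/funext => t.
    by rewrite gauss_subvE dotp_axis.
  have im : stft_im fr fi x (axis n w) = \int[m]_t stft_im_int fr fi (tnth x) w t.
    rewrite /Rintegral -(mE _ iQ) /stft_im; apply: (congr1 fine).
    apply: (congr1 (@iint R n.+1)); apply/funext => t.
    by rewrite gauss_subvE dotp_axis.
  by rewrite /stft_abs re im.
have innerE : inner_abs fr fi = stft_mod m fr fi (fun=> 0) 0.
  have [iP iQ] := stft_int_integrable gint mfr mfi i2 (fun=> 0) 0.
  have re : inner_re fr fi = \int[m]_t stft_re_int fr fi (fun=> 0) 0 t.
    rewrite /Rintegral -(mE _ iP) /inner_re; apply: (congr1 fine).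
    apply: (congr1 (@iint R n.+1)); apply/funext => t.
    by rewrite gaussE /= /stft_re_int !mulr0 cos0 sin0 mulr0 mulr1 addr0.
  have im : inner_im fr fi = \int[m]_t stft_im_int fr fi (fun=> 0) 0 t.
    rewrite /Rintegral -(mE _ iQ) /inner_im; apply: (congr1 fine).
    apply: (congr1 (@iint R n.+1)); apply/funext => t.
    by rewrite gaussE /= /stft_im_int !mulr0 cos0 sin0 mulr0 mulr1 subr0.
  by rewrite /inner_abs re im.
rewrite ltNge; apply/negP => RadN.
have N0 : 0 < N by apply: lt_trans N1.
have pi0 := pi_gt0 R.
(* The only place where the size of [Rad] enters: the growth of the entire function up to the
   boundary lines is compensated by the factor [N]. *)
have eN : expR (pi * Rad ^+ 2) <= N.
  rewrite -[leRHS](@lnK _ N) ?posrE// ler_expR mulrC -ler_pdivlMr//.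
  rewrite -[leRHS]sqr_sqrtr ?divr_ge0 ?ln_ge0 ?(ltW N1) ?(ltW pi0)//.
  by rewrite lerXn2r ?nnegrE ?sqrtr_ge0 ?(ltW Rad0).
have hM y w : `|w| = Rad -> stft_mod m fr fi y w <= inner_abs fr fi / N.
  move=> wR; have yE : tnth (mktuple y) = y.
    by apply/funext => i; rewrite tnth_mktuple.
  by rewrite -yE -stftE hV// enorm_axis.
have strip m0 m00 := gabor_strip gint mfr mfi i2 Rad0 hM (m0 := m0) m00.
have C0 : 0 <= inner_abs fr fi by exact: sqrtr_ge0.
have [Cpos|Cle0] := ltP 0 (inner_abs fr fi).
  have := strip _ Cpos; rewrite mulrCA ger_pMr// ler_pdivrMr// mul1r.
  by move=> /(_ eN (fun=> 0)); rewrite -innerE ltxx.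
have CE : inner_abs fr fi = 0 by apply/eqP; rewrite eq_le Cle0 C0.
have mod0 y : stft_mod m fr fi y 0 = 0.
  (* The bound on the boundary lines is now zero, so [m0] may be the supposedly positive value
     itself, which would then be smaller than itself. *)
  apply/eqP; rewrite eq_le cabs_ge0 andbT leNgt; apply/negP => vpos.
  have := strip _ vpos; rewrite CE mul0r mulr0 => /(_ (ltW vpos) y).
  by rewrite ltxx.
apply: nz; rewrite mE0//.
rewrite (ae_eq_integral (cst 0%E)) ?integral0//.
apply: filterS (gabor_injective gint mfr mfi i2 mod0) => t e _.
by rewrite e.
Qed.
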